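(* There is an absolute constant $C>0$ such that the following holds. Let $s \ge 1$ be an integer, let $0 \le \gamma \le C/s$, and let $A: \mathbb{R}^{s^2} \rightarrow \mathbb{R}^m$ be a linear map. If for every integer $1 \le t \le s$, \[ \Pr_{u\sim \mathrm{Unif}_t}\left( \big|\|Au\|_2^2 - \|u\|_2^2\big| \le \gamma \|u\|_2^2 \right) \ge 0.99,\] then $m \ge s^2/1000$.
   Context: For integers $1 \le t \le s^2$ and real $r>0$, the distribution $\mathrm{Unif}_{t,r}$ on $\mathbb{R}^{s^2}$ is defined as follows: to sample $x \sim \mathrm{Unif}_{t,r}$, first choose a subset of $t$ coordinates of $[s^2]$ uniformly at random to be the support; then the coordinates of $x$ in the support are i.i.d. mean-zero Gaussians with variance $r$, and all other coordinates are $0$. $\mathrm{Unif}_t$ denotes $\mathrm{Unif}_{t,1}$. *)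

(* Defs.v *)
From HB Require Import structures.
From mathcomp Require Import all_boot all_order all_algebra.
From mathcomp Require Import all_classical all_reals all_analysis.

Set Implicit Arguments.
Unset Strict Implicit.
Unset Printing Implicit Defensive.

Import Order.TTheory GRing.Theory Num.Theory.
Import numFieldNormedType.Exports.

Local Open Scope classical_set_scope.
Local Open Scope ring_scope.

Section product_probability.
Context d (T : measurableType d) (R : realType).

Definition cons_tuple_pair n (x : T * n.-tuple T) : n.+1.-tuple T :=
  [tuple of x.1 :: x.2].

Lemma measurable_cons_tuple_pair n :
  measurable_fun [set: T * n.-tuple T] (@cons_tuple_pair n).
Proof. by apply: measurable_cons => //; exact: measurable_snd. Qed.

HB.instance Definition _ n := isMeasurableFun.Build _ _ _ _
  (@cons_tuple_pair n) (@measurable_cons_tuple_pair n).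

Definition pair_prob n (P : probability T R) (Q : probability (n.-tuple T) R) :
  set (T * n.-tuple T) -> \bar R := (P \x Q)%E.

HB.instance Definition _ n P Q := Measure.on (@pair_prob n P Q).

Lemma pair_prob_setT n P Q : @pair_prob n P Q setT = 1%E.
Proof.
rewrite /pair_prob -setXTT product_measure1E//.
by rewrite -[RHS]mule1; congr (_ * _)%E; exact: probability_setT.
Qed.

HB.instance Definition _ n P Q :=
  Measure_isProbability.Build _ _ _ (@pair_prob n P Q) (@pair_prob_setT n P Q).

(* The law of (X_0, ..., X_(n-1)) for independent X_i with X_i ~ P i. *)
Fixpoint prod_prob n : ('I_n -> probability T R) -> probability (n.-tuple T) R :=
  match n with
  | 0 => fun=> \d_[tuple]
  | n'.+1 => fun P => distribution
      (pair_prob (P ord0) (prod_prob (fun i => P (lift ord0 i))))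
      (@cons_tuple_pair n')
  end.

Lemma prod_prob_box n (P : 'I_n -> probability T R) (B : 'I_n -> set T) :
  (forall i, measurable (B i)) ->
  prod_prob P [set x | forall i, B i (tnth x i)] = (\prod_(i < n) P i (B i))%E.
Proof.
elim: n P B => [|n IH] P B mB /=.
  rewrite big_ord0 diracE mem_set//; by case.
rewrite big_ord_recl /distribution /pushforward /= -IH; last by move=> i.
rewrite -product_measure1E//; last first.
  rewrite (_ : [set x | _] = \bigcap_(i in [set: 'I_n])
     ((@tnth n T)^~ i @^-1` B (lift ord0 i))).
    by apply: fin_bigcap_measurable => // i _; rewrite -[X in measurable X]setTI;
       exact: measurable_tnth.
  by apply/seteqP; split => x /= h i; [move=> _|]; apply: h.
rewrite /pair_prob; congr ((_ \x _)%E _); apply/seteqP; split => -[x y] /=.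
  move=> h; split; first by have := h ord0.
  by move=> i; have := h (lift ord0 i); rewrite tnthS.
move=> [h0 hS] i; case: (unliftP ord0 i) => [j ->|-> //].
by rewrite tnthS.
Qed.

End product_probability.

Section sparse_gaussian.
Context (R : realType).
Implicit Types (n t : nat) (r : R).

(* Second parameter of normal_prob is the standard deviation, whereas r is the
   variance; normal_prob is not Gaussian at standard deviation 0. *)
Definition supp_gaussian n r (S : {set 'I_n}) :
    probability (n.-tuple (measurableTypeR R)) R :=
  prod_prob (fun i =>
    if i \in S then normal_prob 0 (Num.sqrt r) : probability (measurableTypeR R) R
    else \d_(0 : measurableTypeR R)).

(* Sampling the support S uniformly among the t-subsets of the n coordinates
   and then from supp_gaussian r S. Intended for t <= n (the sum is empty
   otherwise) and 0 < r. *)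
Definition Unif n t r : set (n.-tuple (measurableTypeR R)) -> \bar R :=
  fun E => (\sum_(S : {set 'I_n} | #|S| == t)
              ('C(n, t)%:R^-1)%:E * supp_gaussian r S E)%E.

Let Unif0 n t r : @Unif n t r set0 = 0%E.
Proof. by apply: big1 => S _; rewrite measure0 mule0. Qed.

Let Unif_ge0 n t r E : (0 <= @Unif n t r E)%E.
Proof. by apply: sume_ge0 => S _; rewrite mule_ge0. Qed.

Let Unif_sigma_additive n t r : semi_sigma_additive (@Unif n t r).
Proof.
move=> F mF tF mUF; rewrite /Unif.
rewrite [X in X @ _ --> _](_ : _ = fun k =>
    (\sum_(S : {set 'I_n} | #|S| == t) \sum_(0 <= i < k)
      ('C(n, t)%:R^-1)%:E * supp_gaussian r S (F i))%E); last first.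
  by apply/funext => k; rewrite exchange_big.
apply: cvg_nnesum => S _.
  by apply: nearW => k; apply: sume_ge0 => i _; rewrite mule_ge0.
rewrite [X in X @ _ --> _](_ : _ = fun k =>
    (('C(n, t)%:R^-1)%:E * \sum_(0 <= i < k) supp_gaussian r S (F i))%E);
  last by apply/funext => k; rewrite ge0_sume_distrr.
by apply: cvgeZl => //; exact: measure_semi_sigma_additive.
Qed.

HB.instance Definition _ n t r := isMeasure.Build _ _ _ (@Unif n t r)
  (@Unif0 n t r) (@Unif_ge0 n t r) (@Unif_sigma_additive n t r).

Lemma Unif_setT n t r : (t <= n)%N -> @Unif n t r setT = 1%E.
Proof.
move=> tn; rewrite /Unif.
under eq_bigr do rewrite probability_setT mule1.
rewrite sumEFin sumr_const; congr EFin.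
rewrite (_ : #|_| = 'C(n, t)); last first.
  by rewrite -[n in RHS]card_ord -card_draws; apply: eq_card => S; rewrite inE.
by rewrite -[_ *+ _]mulr_natr mulVf// pnatr_eq0 -lt0n bin_gt0.
Qed.

(* The squared Euclidean norm; the norm `|v| on matrices is the sup norm. *)
Definition sqnorm k (v : 'rV[R]_k) : R := \sum_(i < k) v 0 i ^+ 2.

Definition row_of_tuple n (x : n.-tuple (measurableTypeR R)) : 'rV[R]_n :=
  \row_i tnth x i.

End sparse_gaussian.

Arguments Unif {R} n t r.

(* Main.v *)
(* Write G for the Gram matrix of the columns of A and n = s^2. On a fixed support
   S, the law of u is invariant under independent sign changes, so the hypothesis
   bounds a Rademacher chaos: flipping the signs of u on T isolates the cross term
   between T and S \ T, and a fourth-moment (Paley-Zygmund) argument shows that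
   the entries of G between T and S \ T have small square sum, for most S.
   Take S uniform of size t = 2h with h = floor(s/4): two independent samples a, b
   of h coordinates then satisfy sum_(k,l) w(a_k, b_l) <= 1/100 with probability
   above 2/3, where w(i,j) = min(100 G_ij^2, 1) off the diagonal and w(i,i) = 1
   (so that collisions count as failures).  Averaging over b bounds the total load
   sum_j min(sum_k w(a_k, j), 1) by O(n/h) = O(h); removing one sample a_k at a time
   then yields a set U of at least 24n/100 coordinates with bounded w-degrees.
   A colouring of U with 151 colours that minimises the weight inside the colour
   classes produces a class I on which G is close to the identity, and
   (tr G_I)^2 <= m |G_I|_F^2 forces m to be of order n.  The case t = 1 controls
   the diagonal of G. *)

Require Import Defs.
From HB Require Import structures.
From mathcomp Require Import all_boot all_order all_algebra.
From mathcomp Require Import all_classical all_reals all_analysis.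
From mathcomp Require Import measurable_realfun ring lra zify.

Set Implicit Arguments.
Unset Strict Implicit.
Unset Printing Implicit Defensive.

Import Order.TTheory GRing.Theory Num.Theory.
Import numFieldNormedType.Exports.

Local Open Scope classical_set_scope.
Local Open Scope ring_scope.

(** * Gaussian coordinates and product laws *)

Section gaussian_marginal.
Context {R : realType}.
Notation mu := (@lebesgue_measure R).

Lemma normal_pdfN (x : R) : normal_pdf 0 1 (- x) = normal_pdf 0 1 x.
Proof. by rewrite !normal_pdfE ?oner_neq0// /normal_fun !subr0 sqrrN. Qed.

(** The density is even and Lebesgue measure is invariant under negation. This is the source of the
    sign symmetry of the coordinates. *)
Lemma normal_probN (A : set (measurableTypeR R)) : measurable A ->
  normal_prob 0 (1 : R) ((-%R : measurableTypeR R -> measurableTypeR R) @^-1` A)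
  = normal_prob 0 (1 : R) A.
Proof.
move=> mA; rewrite /normal_prob.
transitivity (\int[mu]_(x in (-%R : measurableTypeR R -> measurableTypeR R) @^-1` A)
   ((fun x => (normal_pdf 0 1 x)%:E) \o -%R) x)%E.
  by apply: eq_integral => x _ /=; rewrite normal_pdfN.
rewrite -ge0_integral_pushforward//=.
- by apply: eq_measure_integral => B mB _; exact: lebesgue_measureN.
- apply/measurable_EFinP; apply: (measurable_funS measurableT) => //.
  exact: measurable_normal_pdf.
- by move=> x _; rewrite lee_fin normal_pdf_ge0.
Qed.

(** The Radon-Nikodym derivative of the law and its explicit density have the same integral over
    every measurable set, hence agree almost everywhere. *)
Lemma ge0_integral_normal_prob (m s : R) (f : measurableTypeR R -> \bar R) :
  measurable_fun setT f -> (forall x, 0 <= f x)%E ->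
  (\int[normal_prob m s]_x f x = \int[mu]_x (f x * (normal_pdf m s x)%:E))%E.
Proof.
move=> mf f0.
have dom := normal_prob_dominates m s.
rewrite -(Radon_Nikodym_SigmaFinite.change_of_variables dom f0)//.
apply: ae_eq_integral => //.
- apply: emeasurable_funM => //.
  exact: measurable_int (Radon_Nikodym_SigmaFinite.f_integrable dom).
- by apply: emeasurable_funM => //; apply/measurable_EFinP; exact: measurable_normal_pdf.
apply: ae_eqe_mul2l; apply: integral_ae_eq => //.
- exact: Radon_Nikodym_SigmaFinite.f_integrable.
- by apply/measurable_EFinP; exact: measurable_normal_pdf.
- by move=> E _ mE; rewrite -Radon_Nikodym_SigmaFinite.f_integral.
Qed.

(* x^2 e^(-x^2/2) <= 4 e^(-x^2/4), and the right-hand side is a multiple of the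
   density with variance 2 *)
Lemma normal_prob_sqr :
  (\int[normal_prob 0 (1 : R)]_x (x ^+ 2)%:E <= 6%:E)%E.
Proof.
rewrite ge0_integral_normal_prob//; last 2 first.
- by apply/measurable_EFinP; exact: measurable_funX.
- by move=> x; rewrite lee_fin sqr_ge0.
apply: (@le_trans _ _ (\int[mu]_x ((4 * Num.sqrt 2) * (normal_pdf 0 (Num.sqrt 2) x))%:E)%E).
  apply: ge0_le_integral => //.
  - by move=> x _; rewrite lee_fin mulr_ge0 ?sqr_ge0 ?normal_pdf_ge0.
  - apply/measurable_EFinP; apply: measurable_funM; first exact: measurable_funX.
    exact: measurable_normal_pdf.
  - apply/measurable_EFinP; apply: measurable_funM => //.
    exact: measurable_normal_pdf.
  - move=> x _; rewrite -EFinM lee_fin.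
    have s2 : Num.sqrt 2 != 0 :> R by rewrite gt_eqF// sqrtr_gt0.
    rewrite !normal_pdfE ?oner_neq0// /normal_fun /normal_peak !subr0.
    rewrite expr1n mul1r sqr_sqrtr//.
    have -> : Num.sqrt (2 * pi *+ 2) = Num.sqrt 2 * Num.sqrt (pi *+ 2) :> R.
      by rewrite -sqrtrM// -mulrnAr.
    have p0 : 0 < Num.sqrt (pi *+ 2) :> R by rewrite sqrtr_gt0 mulrn_wgt0 ?pi_gt0.
    have s20 : 0 < Num.sqrt 2 :> R by rewrite sqrtr_gt0.
    rewrite invfM.
    have xe : x ^+ 2 * expR (- (x ^+ 2 / 4)) <= 4.
      rewrite expRN -ler_pdivlMr ?invr_gt0 ?expR_gt0// invrK.
      by have := expR_ge1Dx (x ^+ 2 / 4); lra.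
    rewrite (_ : - x ^+ 2 / 2 = - (x ^+ 2 / 4) - (x ^+ 2 / 4)); last by field.
    rewrite (_ : - x ^+ 2 / (2 *+ 2) = - (x ^+ 2 / 4)); last by field.
    rewrite expRD.
    set e := expR _ in xe *; set p := Num.sqrt _; set q := Num.sqrt _.
    have -> : 4 * q * (q^-1 / p * e) = 4 * (p^-1 * e) by field; rewrite !gt_eqF.
    have e0 : 0 <= e := expR_ge0 _.
    rewrite (_ : x ^+ 2 * _ = x ^+ 2 * e * (p^-1 * e)); last by ring.
    by rewrite ler_wpM2r// mulr_ge0// invr_ge0 ltW.
under eq_integral do rewrite EFinM.
rewrite ge0_integralZl//; last 2 first.
- by apply/measurable_EFinP; exact: measurable_normal_pdf.
- by move=> x _; rewrite lee_fin normal_pdf_ge0.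
rewrite integral_normal_pdf mule1 lee_fin.
have : Num.sqrt 2 <= 3 / 2 :> R.
  by rewrite -[leRHS]ger0_norm// -sqrtr_sqr ler_wsqrtr//; lra.
by lra.
Qed.

(** The density is at most 1/2, because pi >= 2, and the interval has length 2e. *)
Lemma normal_prob_small_ball (e : R) : 0 <= e ->
  (normal_prob 0 (1 : R) [set x : measurableTypeR R | (`|x| < e)%R] <= e%:E)%E.
Proof.
move=> e0.
rewrite (_ : [set _ | _] = `]- e, e[%classic); last first.
  by apply/seteqP; split => x /=; rewrite in_itv/= ltr_norml.
rewrite /normal_prob.
apply: (@le_trans _ _ (\int[mu]_(x in `](- e)%R, e[) (cst (2^-1)%:E x))%E).
  apply: ge0_le_integral => //.
  - by move=> x _; rewrite lee_fin normal_pdf_ge0.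
  - by apply: measurable_funTS; apply/measurable_EFinP; exact: measurable_normal_pdf.
  - move=> x _; rewrite lee_fin (le_trans (normal_pdf_ub _ _ _)) ?oner_neq0//.
    have p2 : 2 <= pi :> R := pi_ge2 R.
    rewrite /normal_peak expr1n mul1r lef_pV2 ?posrE ?sqrtr_gt0//; last first.
      by rewrite -mulr_natr; lra.
    rewrite -[leLHS]ger0_norm// -sqrtr_sqr ler_wsqrtr//.
    by rewrite -mulr_natr; lra.
rewrite integral_cst//= lebesgue_measure_itv/= lte_fin.
case: ifPn => _; last by rewrite mule0 lee_fin.
by rewrite -EFinB -EFinM lee_fin; lra.
Qed.

End gaussian_marginal.

(** * Integration against product laws *)

Section product_integrals.
Context d (T : measurableType d) (R : realType).

Lemma ge0_integral_prod_probS n (P : 'I_n.+1 -> probability T R)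
    (F : n.+1.-tuple T -> \bar R) :
  measurable_fun setT F -> (forall x, 0 <= F x)%E ->
  (\int[prod_prob P]_x F x =
   \int[P ord0]_x \int[prod_prob (fun i => P (lift ord0 i))]_y
      F (cons_tuple_pair (x, y)))%E.
Proof.
move=> mF F0 /=.
rewrite (@ge0_integral_distribution _ _ _ _ _
  (pair_prob (P ord0) (prod_prob (fun i => P (lift ord0 i)))) (@cons_tuple_pair _ T n))//.
rewrite (fubini_tonelli1 (F \o @cons_tuple_pair _ T n))//=.
by apply: measurableT_comp => //; exact: measurable_cons_tuple_pair.
Qed.

Lemma ge0_integral_prod_prob_tnth n (P : 'I_n -> probability T R) (i : 'I_n)
    (g : T -> \bar R) : measurable_fun setT g -> (forall x, 0 <= g x)%E ->
  (\int[prod_prob P]_x g (tnth x i) = \int[P i]_x g x)%E.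
Proof.
move=> mg g0; elim: n => [|n IH] in P i *; first by case: i.
rewrite ge0_integral_prod_probS//; last first.
  by apply: measurableT_comp => //; exact: measurable_tnth.
case: (unliftP ord0 i) => [j ->|->].
  transitivity (\int[P ord0]_x (cst (\int[P (lift ord0 j)]_y g y) x))%E.
    apply: eq_integral => x _; rewrite -(IH (fun i => P (lift ord0 i))).
    by apply: eq_integral => y _; rewrite tnthS.
  by rewrite integral_cst// -[RHS]mule1; congr (_ * _)%E; exact: probability_setT.
apply: eq_integral => x _.
transitivity (\int[prod_prob (fun i => P (lift ord0 i))]_y (cst (g x) y))%E.
  by apply: eq_integral => y _; rewrite tnth0.
by rewrite integral_cst// -[RHS]mule1; congr (_ * _)%E; exact: probability_setT.
Qed.

Definition map_coord n (f : 'I_n -> T -> T) (x : n.-tuple T) : n.-tuple T :=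
  [tuple f i (tnth x i) | i < n].

Lemma measurable_map_coord n (f : 'I_n -> T -> T) :
  (forall i, measurable_fun setT (f i)) -> measurable_fun setT (map_coord f).
Proof.
move=> mf; apply/measurable_fun_tnthP => i.
rewrite (_ : _ \o _ = f i \o ((@tnth n T)^~ i)); last first.
  by apply/funext => x /=; rewrite tnth_mktuple.
by apply: measurableT_comp => //; exact: measurable_tnth.
Qed.

(** Fubini and induction: the inner integral absorbs the maps on the tail, and invariance of the
    first marginal absorbs [f ord0]. *)
Lemma ge0_integral_prod_prob_map_coord n (P : 'I_n -> probability T R)
    (f : 'I_n -> T -> T) (F : n.-tuple T -> \bar R) :
  (forall i, measurable_fun setT (f i)) ->
  (forall i A, measurable A -> P i (f i @^-1` A) = P i A) ->
  measurable_fun setT F -> (forall x, 0 <= F x)%E ->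
  (\int[prod_prob P]_x F (map_coord f x) = \int[prod_prob P]_x F x)%E.
Proof.
elim: n => [|n IH] in P f F * => mf Pf mF F0.
  by apply: eq_integral => x _; rewrite [x]tuple0 [map_coord _ _]tuple0.
rewrite !ge0_integral_prod_probS//; last first.
  by apply: measurableT_comp => //; exact: measurable_map_coord.
have mS x : measurable_fun setT (fun y : n.-tuple T => F (cons_tuple_pair (x, y))).
  apply: (measurableT_comp mF); apply: measurableT_comp; first exact: measurable_cons_tuple_pair.
  exact: measurable_fun_pair.
pose h x := (\int[prod_prob (fun i => P (lift ord0 i))]_y F (cons_tuple_pair (x, y)))%E.
transitivity (\int[P ord0]_x h (f ord0 x))%E.
  apply: eq_integral => x _; rewrite /h.
  rewrite -(IH _ (fun i => f (lift ord0 i)) (fun y => F (cons_tuple_pair (f ord0 x, y))))//;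
    last by move=> i A mA; exact: Pf.
  apply: eq_integral => y _; congr F; apply: eq_from_tnth => i.
  rewrite tnth_mktuple; case: (unliftP ord0 i) => [j ->|->].
    by rewrite !tnthS tnth_mktuple.
  by rewrite !tnth0.
have mh : measurable_fun setT h.
  apply: (measurable_fun_fubini_tonelli_F (F \o @cons_tuple_pair _ T n)) => //.
    by apply: measurableT_comp => //; exact: measurable_cons_tuple_pair.
  by move=> z; exact: F0.
have h0 x : (0 <= h x)%E by exact: integral_ge0.
have /= <- := ge0_integral_pushforward (mf ord0) (P ord0) measurableT mh (fun y _ => h0 y).
by apply: eq_measure_integral => A mA _; exact: Pf.
Qed.

End product_integrals.

(** * Rademacher chaos *)

Section rademacher.
Context {R : realType} {I : finType}.
Local Notation signs := {ffun I -> bool}.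
Local Notation N := (#|{: signs}|%:R : R).
Implicit Types (i : I) (g : signs) (a b : I -> R) (r : seq I).

Definition sgn g i : R := (-1) ^+ g i.

Definition flip i g : signs := [ffun k => if k == i then ~~ g k else g k].

Lemma flipK i : involutive (flip i).
Proof. by move=> g; apply/ffunP => k; rewrite !ffunE; case: eqP => // _; rewrite negbK. Qed.

Lemma sgn_sqr g i : sgn g i ^+ 2 = 1.
Proof. by rewrite /sgn sqrr_sign. Qed.

Lemma sgn_flip g i k : sgn (flip i g) k = if k == i then - sgn g k else sgn g k.
Proof. by rewrite /sgn ffunE; case: eqP => // _; rewrite signrN. Qed.

(** The involution [flip i] negates every summand. *)
Lemma sum_sgn_even i (F : signs -> R) :
  (forall g, F (flip i g) = F g) -> \sum_g sgn g i * F g = 0.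
Proof.
move=> Fi; have : \sum_g sgn g i * F g = - \sum_g sgn g i * F g; last by lra.
rewrite -sumrN [LHS](reindex_inj (inv_inj (flipK i))).
by apply: eq_bigr => g _; rewrite sgn_flip eqxx Fi mulNr.
Qed.

Definition rad r a g : R := \sum_(i <- r) a i * sgn g i.

Lemma rad_cons i r a g : rad (i :: r) a g = a i * sgn g i + rad r a g.
Proof. by rewrite /rad big_cons. Qed.

Lemma rad_flip i r a g : i \notin r -> rad r a (flip i g) = rad r a g.
Proof.
move=> ir; apply: eq_big_seq => k kr; rewrite sgn_flip.
by case: eqP => // ki; rewrite -ki kr in ir.
Qed.

Lemma sum_rad_mul r a b : uniq r ->
  \sum_g rad r a g * rad r b g = N * \sum_(i <- r) a i * b i.
Proof.
elim: r => [_|i r IH /= /andP[ir ur]].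
  rewrite big_nil mulr0; apply: big1 => g _; by rewrite /rad big_nil mul0r.
rewrite big_cons mulrDr -IH//.
transitivity (\sum_g (a i * b i + rad r a g * rad r b g
    + sgn g i * (a i * rad r b g + b i * rad r a g))).
  apply: eq_bigr => g _; rewrite !rad_cons.
  by rewrite /sgn; case: (g i); rewrite ?expr0 ?expr1; ring.
rewrite !big_split/= sum_sgn_even ?addr0; last by move=> g; rewrite !rad_flip.
by rewrite sumr_const mulr_natl.
Qed.

(** A mixed fourth-moment bound, with constant 3 as for Gaussians. Two coefficient vectors are
    needed because [sum_birad_4] applies it to pairs of rows. *)
Lemma sum_rad_sqr_mul r a b : uniq r ->
  \sum_g rad r a g ^+ 2 * rad r b g ^+ 2
  <= 3 * N * ((\sum_(i <- r) a i ^+ 2) * (\sum_(i <- r) b i ^+ 2)).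
Proof.
elim: r => [_|i r IH /= /andP[ir ur]].
  rewrite !big_nil !mulr0 big1// => g _; by rewrite /rad !big_nil expr0n mul0r.
rewrite !big_cons.
(* The even part in the sign at [i] also contains 4 [a i] [b i] times the product of both tail sums;
   AM-GM splits it between the two squares and raises their coefficients from 1 to 3. *)
apply: (@le_trans _ _ (\sum_g (a i ^+ 2 * b i ^+ 2
    + 3 * a i ^+ 2 * rad r b g ^+ 2 + 3 * b i ^+ 2 * rad r a g ^+ 2
    + rad r a g ^+ 2 * rad r b g ^+ 2))); last first.
  have sq c : \sum_g rad r c g ^+ 2 = N * \sum_(j <- r) c j ^+ 2.
    by under eq_bigr do rewrite expr2; rewrite sum_rad_mul.
  rewrite !big_split/= -!mulr_sumr !sq sumr_const -[_ *+ _]mulr_natr.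
  have := IH ur; set S4 := \sum_g _.
  set X := \sum_(j <- r) a j ^+ 2; set Y := \sum_(j <- r) b j ^+ 2 => IH'.
  have := mulr_ge0 (ler0n R #|{: signs}|) (mulr_ge0 (sqr_ge0 (a i)) (sqr_ge0 (b i))).
  by rewrite -/signs; nra.
rewrite -subr_ge0 -sumrB.
(* [o] is the coefficient of the sign at [i], so the odd part sums to zero. *)
pose o g := 2 * a i ^+ 2 * b i * rad r b g + 2 * a i * b i ^+ 2 * rad r a g
   + 2 * a i * rad r a g * rad r b g ^+ 2 + 2 * b i * rad r a g ^+ 2 * rad r b g.
have o0 : \sum_g sgn g i * o g = 0.
  by apply: sum_sgn_even => g; rewrite /o !rad_flip.
rewrite -[leRHS]addr0 -[X in _ + X]o0 -big_split/=; apply: sumr_ge0 => g _.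
have := sqr_ge0 (a i * rad r b g - b i * rad r a g).
by rewrite /o !rad_cons /sgn; case: (g i); rewrite ?expr0 ?expr1; nra.
Qed.

Lemma sum_rad_sqr r a : uniq r ->
  \sum_g rad r a g ^+ 2 = N * \sum_(i <- r) a i ^+ 2.
Proof. by move=> ur; under eq_bigr do rewrite expr2; rewrite sum_rad_mul. Qed.

(** The decoupled Rademacher chaos of order two with coefficient matrix [D]. *)
Definition birad (D : I -> I -> R) (gg : signs * signs) : R :=
  \sum_i \sum_j D i j * (sgn gg.1 i * sgn gg.2 j).

Let z D i g := rad (index_enum I) (D i) g.

Let biradE D gg : birad D gg = rad (index_enum I) (fun i => z D i gg.2) gg.1.
Proof.
apply: eq_bigr => i _; rewrite mulr_suml; apply: eq_bigr => j _.
by ring.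
Qed.

Lemma sum_birad_sqr D :
  \sum_gg birad D gg ^+ 2 = N ^+ 2 * \sum_i \sum_j D i j ^+ 2.
Proof.
rewrite -(pair_bigA _ (fun g g' => birad D (g, g') ^+ 2)) exchange_big/=.
transitivity (\sum_g' N * \sum_i z D i g' ^+ 2).
  apply: eq_bigr => g' _; rewrite -sum_rad_sqr ?index_enum_uniq//.
  by apply: eq_bigr => g _; rewrite biradE.
rewrite -mulr_sumr exchange_big/= expr2 -mulrA; congr (_ * _).
rewrite mulr_sumr; apply: eq_bigr => i _.
by rewrite sum_rad_sqr ?index_enum_uniq.
Qed.

(** For fixed second signs the chaos is a Rademacher sum with coefficients [z D i]. The
    fourth-moment bound is applied once for each family of signs, whence 9 = 3 * 3. *)
Lemma sum_birad_4 D :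
  \sum_gg (birad D gg ^+ 2) ^+ 2 <= 9 * (N ^+ 2 * (\sum_i \sum_j D i j ^+ 2) ^+ 2).
Proof.
rewrite -(pair_bigA _ (fun g g' => (birad D (g, g') ^+ 2) ^+ 2)) exchange_big/=.
apply: (@le_trans _ _ (\sum_g' 3 * N * (\sum_i z D i g' ^+ 2) ^+ 2)).
  apply: ler_sum => g' _; rewrite [X in _ <= _ * X]expr2.
  apply: le_trans (sum_rad_sqr_mul _ _ (index_enum_uniq I)).
  by apply: ler_sum => g _; rewrite biradE [X in X <= _]expr2.
rewrite -mulr_sumr.
rewrite (_ : 9 * _ = 3 * N * (3 * N * (\sum_i \sum_j D i j ^+ 2) ^+ 2)); last by ring.
rewrite ler_wpM2l// ?mulr_ge0//.
have -> : \sum_g' (\sum_i z D i g' ^+ 2) ^+ 2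
    = \sum_g' \sum_i \sum_k z D i g' ^+ 2 * z D k g' ^+ 2.
  by apply: eq_bigr => g' _; rewrite expr2 big_distrlr.
rewrite exchange_big/= [X in _ <= _ * X]expr2 big_distrlr/= mulr_sumr; apply: ler_sum => i _.
rewrite exchange_big/= mulr_sumr; apply: ler_sum => k _.
by apply: sum_rad_sqr_mul; rewrite index_enum_uniq.
Qed.

End rademacher.

Lemma sumr_mem {R : realType} (T : finType) (B : {set T}) :
  \sum_x (x \in B)%:R = #|B|%:R :> R.
Proof. by rewrite -sum1_card natr_sum [RHS]big_mkcond; apply: eq_bigr => x _; case: ifP. Qed.

(* The two halves of the AM-GM bound Z <= (Z^2 / k + k) / 2, k = 19/2 m, on B
   contribute at most 9/19 + 19/40 < 19/20 of the mean m. *)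
Lemma mean_le_of_fourth_moment {R : realType} (T : finType) (Z : T -> R)
    (B : {set T}) (m c : R) :
  (0 < #|T|)%N ->
  (forall x, 0 <= Z x) ->
  \sum_x Z x = #|T|%:R * m -> \sum_x Z x ^+ 2 <= 9 * (#|T|%:R * m ^+ 2) ->
  #|B|%:R <= #|T|%:R / 10 :> R -> 0 <= c ->
  (forall x, x \notin B -> Z x <= c) -> m <= 20 * c.
Proof.
rewrite -(ltr0n R) => T0 Z0 Z1 Z2 Bq c0 Zc.
have [m0|m0] := leP m 0; first by lra.
have k0 : 0 < 19 / 2 * m by lra.
have : \sum_x Z x <= \sum_x (c + (19 / 2 * m)^-1 / 2 * Z x ^+ 2
    + 19 / 4 * m * (x \in B)%:R).
  apply: ler_sum => x _; have zz := sqr_ge0 (Z x - 19 / 2 * m).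
  have [xB|xB] := boolP (x \in B); last first.
    have : 0 <= (19 / 2 * m)^-1 / 2 * Z x ^+ 2.
      by rewrite mulr_ge0 ?sqr_ge0// mulr_ge0// invr_ge0 ltW.
    by have := Zc _ xB; rewrite mulr0; lra.
  rewrite mulr1.
  have : 0 <= (19 / 2 * m)^-1 / 2 * (Z x - 19 / 2 * m) ^+ 2.
    by rewrite mulr_ge0 ?sqr_ge0// mulr_ge0// invr_ge0 ltW.
  rewrite (_ : _ * (_ - _) ^+ 2 =
    (19 / 2 * m)^-1 / 2 * Z x ^+ 2 - Z x + 19 / 4 * m); first by lra.
  by field; lra.
rewrite !big_split/= sumr_const -!mulr_sumr Z1 sumr_mem -[_ *+ _]mulr_natr => le1.
have le2 : (19 / 2 * m)^-1 / 2 * (\sum_x Z x ^+ 2) <= 9 / 19 * (#|T|%:R * m).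
  apply: le_trans (_ : (19 / 2 * m)^-1 / 2 * (9 * (#|T|%:R * m ^+ 2)) <= _).
    by rewrite ler_wpM2l// mulr_ge0// invr_ge0 ltW.
  by rewrite le_eqVlt; apply/orP; left; apply/eqP; field; lra.
have le3 : 19 / 4 * m * #|B|%:R <= 19 / 4 * m * (#|T|%:R / 10).
  by rewrite ler_wpM2l//; lra.
have : #|T|%:R * m <= #|T|%:R * (20 * c) by nra.
by rewrite ler_pM2l.
Qed.

(** * The Gram matrix and random signs on a fixed vector *)

Section gram.
Context {R : realType}.

Definition dotp k (u v : 'rV[R]_k) : R := \sum_(i < k) u 0 i * v 0 i.

Lemma sqnormE k (u : 'rV[R]_k) : sqnorm u = dotp u u.
Proof. by apply: eq_bigr => i _; rewrite expr2. Qed.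

Lemma sqnorm_ge0 k (u : 'rV[R]_k) : 0 <= sqnorm u.
Proof. by apply: sumr_ge0 => i _; exact: sqr_ge0. Qed.

Lemma sqnormD k (u v : 'rV[R]_k) :
  sqnorm (u + v) = sqnorm u + sqnorm v + 2 * dotp u v.
Proof.
rewrite /dotp mulr_sumr -!big_split/=; apply: eq_bigr => i _.
by rewrite !mxE; ring.
Qed.

Lemma sqnormN k (u : 'rV[R]_k) : sqnorm (- u) = sqnorm u.
Proof. by apply: eq_bigr => i _; rewrite mxE sqrrN. Qed.

Lemma dotpNl k (u v : 'rV[R]_k) : dotp (- u) v = - dotp u v.
Proof. by rewrite -sumrN; apply: eq_bigr => i _; rewrite mxE mulNr. Qed.

Context {n m : nat} (A : {linear 'rV[R]_n -> 'rV[R]_m}).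

Definition gram (i j : 'I_n) : R := dotp (A (delta_mx 0 i)) (A (delta_mx 0 j)).

Lemma gramC i j : gram i j = gram j i.
Proof. by apply: eq_bigr => k _; rewrite mulrC. Qed.

Lemma linear_rowE (y : 'rV[R]_n) k :
  A y 0 k = \sum_i y 0 i * A (delta_mx 0 i) 0 k.
Proof.
rewrite {1}(row_sum_delta y) linear_sum/= summxE.
by apply: eq_bigr => i _; rewrite linearZ mxE.
Qed.

Lemma dotp_gram (y z : 'rV[R]_n) :
  dotp (A y) (A z) = \sum_i \sum_j gram i j * (y 0 i * z 0 j).
Proof.
transitivity (\sum_k \sum_i \sum_j
    A (delta_mx 0 i) 0 k * A (delta_mx 0 j) 0 k * (y 0 i * z 0 j)).
  apply: eq_bigr => k _; rewrite !linear_rowE big_distrlr/=.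
  by apply: eq_bigr => i _; apply: eq_bigr => j _; ring.
rewrite exchange_big/=; apply: eq_bigr => i _.
by rewrite exchange_big/=; apply: eq_bigr => j _; rewrite mulr_suml.
Qed.

Local Notation signs := {ffun 'I_n -> bool}.

(** Signs on [T] and off [T] come from separate families, so that the cross term between [T] and its
    complement is a decoupled chaos. *)
Definition mixed_sgn (T : {set 'I_n}) (gg : signs * signs) (i : 'I_n) : R :=
  if i \in T then sgn gg.1 i else sgn gg.2 i.

Lemma mixed_sgn_sqr T gg i : mixed_sgn T gg i ^+ 2 = 1.
Proof. by rewrite /mixed_sgn; case: ifP => _; rewrite sgn_sqr. Qed.

Definition mix T gg (x : 'rV[R]_n) : 'rV[R]_n := \row_i (mixed_sgn T gg i * x 0 i).

Lemma sqnorm_mix T gg x : sqnorm (mix T gg x) = sqnorm x.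
Proof. by apply: eq_bigr => i _; rewrite mxE exprMn mixed_sgn_sqr mul1r. Qed.

Definition near_isometric (gamma : R) (x : 'rV[R]_n) : bool :=
  `|sqnorm (A x) - sqnorm x| <= gamma * sqnorm x.

(** Flipping all signs on [T] keeps the norm of the vector and changes the squared norm of its image
    by four times the chaos. Where both vectors are nearly isometric, the chaos is at most half of
    [gamma * sqnorm x]; [mean_le_of_fourth_moment] then bounds its mean square. *)
Lemma cross_gram_bound (T : {set 'I_n}) gamma (x : 'rV[R]_n) : 0 <= gamma ->
  #|[set gg | ~~ near_isometric gamma (mix T gg x)]%SET|%:R
    <= #|{: signs * signs}|%:R / 20 :> R ->
  \sum_(i in T) \sum_(j in ~: T) (gram i j * (x 0 i * x 0 j)) ^+ 2
    <= 5 * (gamma * sqnorm x) ^+ 2.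
Proof.
move=> gamma0 Fq; set F := [set gg | _]%SET in Fq.
pose D i j := if (i \in T) && (j \in ~: T) then gram i j * (x 0 i * x 0 j) else 0.
pose opp (gg : signs * signs) : signs * signs := ([ffun i => ~~ gg.1 i], gg.2).
have oppK : involutive opp.
  by case=> g g'; congr pair; apply/ffunP => i; rewrite !ffunE negbK.
have biradD gg : sqnorm (A (mix T gg x)) - sqnorm (A (mix T (opp gg) x))
    = 4 * birad D gg.
  pose y := \row_i (if i \in T then sgn gg.1 i * x 0 i else 0) : 'rV[R]_n.
  pose z := \row_i (if i \in T then 0 else sgn gg.2 i * x 0 i) : 'rV[R]_n.
  have -> : mix T gg x = y + z.
    by apply/rowP => i; rewrite !mxE /mixed_sgn; case: ifP; rewrite ?addr0 ?add0r.
  have -> : mix T (opp gg) x = - y + z.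
    apply/rowP => i; rewrite !mxE /mixed_sgn; case: ifP; rewrite ?oppr0 ?addr0 ?add0r//.
    by rewrite /sgn ffunE signrN mulNr.
  rewrite !linearD linearN !sqnormD sqnormN dotpNl.
  have -> : birad D gg = dotp (A y) (A z); last by ring.
  rewrite dotp_gram; apply: eq_bigr => i _; apply: eq_bigr => j _.
  rewrite /D !mxE inE; case: (i \in T); case: (j \in T); rewrite /= ?(mulr0, mul0r)//.
  by ring.
have sumD : \sum_i \sum_j D i j ^+ 2 =
    \sum_(i in T) \sum_(j in ~: T) (gram i j * (x 0 i * x 0 j)) ^+ 2.
  rewrite [RHS]big_mkcond; apply: eq_bigr => i _.
  case: ifPn => iT; last by apply: big1 => j _; rewrite /D (negbTE iT) expr0n.
  rewrite [RHS]big_mkcond; apply: eq_bigr => j _.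
  by rewrite /D iT/=; case: ifP => _ //; rewrite expr0n.
rewrite -sumD.
(* The factor 20 comes from [mean_le_of_fourth_moment]. *)
have -> : 5 * (gamma * sqnorm x) ^+ 2 = 20 * ((gamma * sqnorm x) / 2) ^+ 2 by field.
have card2 : #|{: signs * signs}|%:R = #|{: signs}|%:R ^+ 2 :> R.
  by rewrite card_prod natrM expr2.
(* The exceptional set doubles from 1/20 to 1/10, since both [gg] and [opp gg] have to be nearly
   isometric. *)
apply: (@mean_le_of_fourth_moment _ _ (fun gg => birad D gg ^+ 2) (F :|: opp @^-1: F)).
- by rewrite card_prod muln_gt0 card_ffun expn_gt0 card_bool.
- by move=> gg; exact: sqr_ge0.
- by rewrite sum_birad_sqr card2.
- by rewrite card2; exact: sum_birad_4.
- have : (#|F :|: opp @^-1: F| <= #|F| + #|F|)%N.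
    rewrite -[X in (_ <= _ + X)%N](card_preimset F (inv_inj oppK)).
    by rewrite cardsU leq_subr.
  by rewrite -(ler_nat R) natrD; lra.
- exact: sqr_ge0.
move=> gg; rewrite !inE => /norP[]; rewrite !negbK => h1 h2.
have h3 := biradD gg; move: h1 h2; rewrite /near_isometric !sqnorm_mix.
rewrite !ler_norml => /andP[a1 a2] /andP[b1 b2].
rewrite -(real_normK (num_real (birad D gg))) ler_sqr ?nnegrE//; last first.
  by rewrite mulr_ge0// mulr_ge0// sqnorm_ge0.
rewrite ler_norml; apply/andP; split; lra.
Qed.

End gram.

(** * Gaussian vectors with a fixed support *)

Section fixed_support.
Context {R : realType}.

Lemma exists_lt_integral d (T : measurableType d) (P : probability T R)
    (F : T -> R) (c : R) : 0 <= c ->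
  measurable_fun setT F -> (\int[P]_x (F x)%:E < c%:E)%E ->
  exists x, F x < c.
Proof.
move=> c0 mF Fc; apply: contrapT => /forallNP nF.
have cF x : c <= F x by rewrite leNgt; apply/negP/nF.
move: Fc; rewrite ltNge => /negP; apply.
apply: (@le_trans _ _ (\int[P]_x (cst c%:E x))%E).
  rewrite integral_cst// -[leLHS]mule1 le_eqVlt; apply/orP; left; apply/eqP.
  by congr (_ * _)%E; apply/esym; exact: probability_setT.
apply: ge0_le_integral => //.
- exact/measurable_EFinP.
- by move=> x _; rewrite lee_fin.
Qed.

Context {n m : nat} (A : {linear 'rV[R]_n -> 'rV[R]_m}).
Local Notation RR := (measurableTypeR R).

Lemma measurable_near_isometric gamma :
  measurable [set x : n.-tuple RR | near_isometric A gamma (row_of_tuple x)].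
Proof.
have mu i : measurable_fun setT (fun x : n.-tuple RR => row_of_tuple x 0 i).
  under eq_fun do rewrite mxE.
  exact: measurable_tnth.
have mU : measurable_fun setT (fun x : n.-tuple RR => sqnorm (row_of_tuple x)).
  rewrite /sqnorm; apply: measurable_sum => i.
  exact: measurable_funX.
have mA : measurable_fun setT (fun x : n.-tuple RR => sqnorm (A (row_of_tuple x))).
  apply: measurable_sum => k; apply: measurable_funX.
  under eq_fun do rewrite linear_rowE.
  by apply: measurable_sum => i; apply: measurable_funM.
have mb : measurable_fun setT
    (fun x : n.-tuple RR => near_isometric A gamma (row_of_tuple x)).
  apply: measurable_fun_ler; last exact: measurable_funM.
  by apply: measurableT_comp => //; apply: measurable_funB.
rewrite (_ : [set _ | _] = setT `&`
  (fun x : n.-tuple RR => near_isometric A gamma (row_of_tuple x)) @^-1` [set true]).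
  exact: mb.
by rewrite setTI.
Qed.

(** [Num.sqrt 1] is left unreduced so that [supp_gaussian 1 S] is the product of these laws by
    conversion. *)
Definition coord_law (S : {set 'I_n}) i : probability RR R :=
  if i \in S then normal_prob 0 (Num.sqrt 1) : probability RR R else \d_(0 : RR).

Lemma coord_law_sign S i (s : R) (B : set RR) : s ^+ 2 = 1 -> measurable B ->
  coord_law S i ((fun y : RR => s * y : RR) @^-1` B) = coord_law S i B.
Proof.
move=> /eqP; rewrite sqrf_eq1 => /orP[] /eqP -> mB.
  by congr (coord_law S i _); apply/seteqP; split => y /=; rewrite mul1r.
rewrite (_ : _ @^-1` B = (-%R : RR -> RR) @^-1` B); last first.
  by apply/seteqP; split => y /=; rewrite mulN1r.
rewrite /coord_law; case: ifP => _; first by rewrite sqrtr1; exact: normal_probN.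
by rewrite /= /dirac !indicE; rewrite (_ : (0 \in -%R @^-1` B) = (0 \in B))//; apply/idP/idP; rewrite !inE /= oppr0.
Qed.

Lemma coord_law_sqr S i :
  (\int[coord_law S i]_y (y ^+ 2)%:E <= (6 * (i \in S)%:R)%:E)%E.
Proof.
rewrite /coord_law; case: ifP => _; first by rewrite mulr1 sqrtr1 normal_prob_sqr.
rewrite integral_dirac//; last by apply/measurable_EFinP; exact: measurable_funX.
by rewrite expr0n mule0 mulr0.
Qed.

Lemma coord_law_small (S : {set 'I_n}) i (e : R) : 0 <= e -> i \in S ->
  (coord_law S i [set y : RR | (`|y| < e)%R] <= e%:E)%E.
Proof.
by move=> e0 iS; rewrite /coord_law iS sqrtr1; exact: normal_prob_small_ball.
Qed.

Lemma supp_gaussianE (S : {set 'I_n}) : supp_gaussian (1 : R) S = prod_prob (coord_law S).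
Proof. by []. Qed.

Definition far gamma : set (n.-tuple RR) :=
  [set x | ~~ near_isometric A gamma (row_of_tuple x)].

Lemma measurable_far gamma : measurable (far gamma).
Proof.
rewrite (_ : far gamma = ~` [set x | near_isometric A gamma (row_of_tuple x)]).
  by apply: measurableC; exact: measurable_near_isometric.
by apply/seteqP; split => x /= /negP.
Qed.

(** The law on a fixed support is invariant under each sign pattern, so random signs can be averaged
    in without changing the failure probability. *)
Lemma integral_far_mix (S : {set 'I_n}) gamma T gg :
  (\int[supp_gaussian (1 : R) S]_x (\1_(far gamma) (map_coord (fun i (y : RR) => mixed_sgn T gg i * y : RR) x))%:E
   = supp_gaussian (1 : R) S (far gamma))%E.
Proof.
rewrite supp_gaussianE.
rewrite (@ge0_integral_prod_prob_map_coord _ RR R n (coord_law S) _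
  (fun x => (\1_(far gamma) x)%:E)).
- by rewrite integral_indic ?setIT//; exact: measurable_far.
- by move=> i; apply: measurable_funM.
- by move=> i B mB; apply: coord_law_sign => //; exact: mixed_sgn_sqr.
- by apply/measurable_EFinP; apply: measurable_indic; exact: measurable_far.
- by move=> x; rewrite lee_fin.
Qed.

Lemma row_of_tuple_mix T gg (x : n.-tuple RR) :
  row_of_tuple (map_coord (fun i (y : RR) => mixed_sgn T gg i * y : RR) x)
  = mix T gg (row_of_tuple x).
Proof. by apply/rowP => i; rewrite !mxE tnth_mktuple. Qed.

Lemma integral_coord_sqr (S : {set 'I_n}) i :
  (\int[supp_gaussian (1 : R) S]_x (tnth x i ^+ 2)%:E <= (6 * (i \in S)%:R)%:E)%E.
Proof.
rewrite supp_gaussianE.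
rewrite (@ge0_integral_prod_prob_tnth _ RR R n (coord_law S) i (fun y : RR => ((y : R) ^+ 2)%:E)).
- exact: coord_law_sqr.
- by apply/measurable_EFinP; exact: measurable_funX.
- by move=> x; rewrite lee_fin sqr_ge0.
Qed.

Definition small (e : R) : set RR := [set y | (`|y| < e)%R].

Lemma measurable_small e : measurable (small e).
Proof.
rewrite (_ : small e = `]- e, e[%classic) //.
by apply/seteqP; split => x; rewrite /small /= in_itv/= ltr_norml.
Qed.

Lemma integral_coord_indic (S : {set 'I_n}) i (B : set RR) : measurable B ->
  (\int[supp_gaussian (1 : R) S]_x (\1_B (tnth x i))%:E = coord_law S i B)%E.
Proof.
move=> mB; rewrite supp_gaussianE.
rewrite (@ge0_integral_prod_prob_tnth _ RR R n (coord_law S) i (fun y : RR => (\1_B y)%:E)).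
- by rewrite integral_indic ?setIT.
- by apply/measurable_EFinP; exact: measurable_indic.
- by move=> x; rewrite lee_fin.
Qed.

Lemma integral_coord_small (S : {set 'I_n}) i (e : R) : 0 <= e -> i \in S ->
  (\int[supp_gaussian (1 : R) S]_x (\1_(small e) (tnth x i))%:E <= e%:E)%E.
Proof.
move=> e0 iS; rewrite integral_coord_indic; last exact: measurable_small.
exact: coord_law_small.
Qed.

End fixed_support.

(** * Cross entries of the Gram matrix inside one good support *)

Section fixed_support_bound.
Context {R : realType}.
Local Notation RR := (measurableTypeR R).

Lemma integral_lincomb_le d (T : measurableType d) (P : probability T R)
    (K : finType) (c I : K -> R) (F : K -> T -> R) :
  (forall k, 0 <= c k) -> (forall k, measurable_fun setT (F k)) ->
  (forall k x, 0 <= F k x) -> (forall k, \int[P]_x (F k x)%:E <= (I k)%:E)%E ->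
  (\int[P]_x (\sum_k c k * F k x)%:E <= (\sum_k c k * I k)%:E)%E.
Proof.
move=> c0 mF F0 FI.
under eq_integral do rewrite -sumEFin.
rewrite ge0_integral_sum//.
- rewrite -sumEFin; apply: lee_sum => k _.
  under eq_integral do rewrite EFinM.
  rewrite ge0_integralZl//.
  + by rewrite EFinM lee_pmul//; [rewrite lee_fin|apply: integral_ge0 => x _; rewrite lee_fin].
  + exact/measurable_EFinP.
  + by move=> x _; rewrite lee_fin.
  + by rewrite lee_fin.
- by move=> k; apply/measurable_EFinP; apply: measurable_funM.
- by move=> k x _; rewrite lee_fin mulr_ge0.
Qed.

Lemma integralD_le d (T : measurableType d) (P : probability T R)
    (F G : T -> R) (a b : R) :
  measurable_fun setT F -> measurable_fun setT G ->
  (forall x, 0 <= F x) -> (forall x, 0 <= G x) ->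
  (\int[P]_x (F x)%:E <= a%:E)%E -> (\int[P]_x (G x)%:E <= b%:E)%E ->
  (\int[P]_x (F x + G x)%:E <= (a + b)%:E)%E.
Proof.
move=> mF mG F0 G0 Fa Gb; under eq_integral do rewrite EFinD.
rewrite ge0_integralD//.
- by rewrite EFinD leeD.
- by move=> x _; rewrite lee_fin.
- exact/measurable_EFinP.
- by move=> x _; rewrite lee_fin.
- exact/measurable_EFinP.
Qed.

Context {n m : nat} (A : {linear 'rV[R]_n -> 'rV[R]_m}).
Local Notation signs := {ffun 'I_n -> bool}.

(** One functional [psi] of mean below 1 replaces a union bound. It yields a single vector that is
    nearly isometric under most sign patterns, is not too long, and has few small coordinates as
    weighted by the Gram entries; [cross_gram_bound] is applied to that vector. *)
Lemma support_cross_gram_bound_aux (S T : {set 'I_n}) (gamma e L Q : R) :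
  Q = \sum_(i in T) \sum_(j in S :\: T) gram A i j ^+ 2 ->
  T \subset S -> 0 <= gamma -> 0 <= e -> e <= 1 / 100 -> 6 * 100 <= L ->
  (supp_gaussian (1 : R) S (far A gamma) <= (9 / 200)%:E)%E ->
  e ^+ 4 * (Q / 2) <= 5 * (gamma * (L * #|S|%:R)) ^+ 2.
Proof.
move=> QE TS gamma0 e0 e100 L6 Pfar; have L0 : 0 < L by lra.
have [Q0|Q0] := leP Q 0.
  apply: (@le_trans _ _ 0); last by rewrite mulr_ge0 ?sqr_ge0.
  by rewrite mulr_ge0_le0 ?exprn_ge0//; lra.
have t0 : 0 < #|S|%:R :> R.
  rewrite ltr0n card_gt0; apply/eqP => S0; move: Q0; rewrite QE.
  by move: TS; rewrite S0 finset.subset0 => /eqP ->; rewrite big_set0 ltxx.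
set t := #|S|%:R in t0 *.
pose N : R := #|{: signs * signs}|%:R.
have N0 : 0 < N by rewrite ltr0n card_prod muln_gt0 card_ffun expn_gt0 card_bool.
pose f gg (x : n.-tuple RR) := map_coord (fun i (y : RR) => mixed_sgn T gg i * y : RR) x.
pose in_rect (p : 'I_n * 'I_n) := (p.1 \in T) && (p.2 \in S :\: T).
pose F1 (gg : signs * signs) (x : n.-tuple RR) : R := \1_(far A gamma) (f gg x).
pose F2 i (x : n.-tuple RR) : R := tnth x i ^+ 2.
pose sm i (x : n.-tuple RR) : R := \1_(small e) (tnth x i).
pose F3 p (x : n.-tuple RR) : R := if in_rect p then sm p.1 x + sm p.2 x else 0.
have msm i : measurable_fun setT (sm i).
  apply: (@measurableT_comp _ _ _ _ _ _ (\1_(small e) : RR -> R)).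
    by apply: measurable_indic; exact: measurable_small.
  exact: measurable_tnth.
have mF1 gg : measurable_fun setT (F1 gg).
  apply: (@measurableT_comp _ _ _ _ _ _ (\1_(far A gamma) : n.-tuple RR -> R)).
    by apply: measurable_indic; exact: measurable_far.
  by apply: measurable_map_coord => i; exact: measurable_funM.
have mF2 i : measurable_fun setT (F2 i).
  by apply: measurable_funX; exact: measurable_tnth.
have mF3 p : measurable_fun setT (F3 p).
  rewrite /F3; case: (in_rect p); last exact: measurable_cst.
  exact: measurable_funD.
have F10 gg x : 0 <= F1 gg x by [].
have F20 i x : 0 <= F2 i x by exact: sqr_ge0.
have F30 p x : 0 <= F3 p x by rewrite /F3; case: ifP => // _; exact: addr_ge0.
(* The weights are normalised so that a weighted sum below 1 means, respectively: fewer than 1/20 of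
   the sign patterns fail, the squared norm is below L t, and the Gram weight touched by small
   coordinates is below Q / 2. *)
pose w1 (gg : signs * signs) : R := 20 / N.
pose w2 (i : 'I_n) : R := (L * t)^-1.
pose w3 (p : 'I_n * 'I_n) : R := 2 * gram A p.1 p.2 ^+ 2 / Q.
have w10 gg : 0 <= w1 gg by rewrite /w1; apply: divr_ge0; [exact: ler0n|exact: ltW].
have w20 i : 0 <= w2 i by rewrite /w2 invr_ge0; apply: mulr_ge0; [exact: ltW|exact: ltW].
have w30 p : 0 <= w3 p by rewrite /w3; apply: divr_ge0; [apply: mulr_ge0; [exact: ler0n|exact: sqr_ge0]|exact: ltW].
have I1 : (\int[supp_gaussian (1 : R) S]_x (\sum_gg w1 gg * F1 gg x)%:E <= (9 / 10)%:E)%E.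
  rewrite (_ : 9 / 10 = \sum_gg w1 gg * (9 / 200)).
    by apply: integral_lincomb_le => // gg; rewrite integral_far_mix.
  by rewrite -mulr_suml sumr_const -mulr_natr -/N; field; lra.
have I2 : (\int[supp_gaussian (1 : R) S]_x (\sum_i w2 i * F2 i x)%:E <= (1 / 100)%:E)%E.
  apply: (@le_trans _ _ (\sum_i w2 i * (6 * (i \in S)%:R))%:E).
    by apply: integral_lincomb_le => // i; exact: integral_coord_sqr.
  rewrite lee_fin -!mulr_sumr sumr_mem -/t invfM mulrCA -mulrA mulVf ?gt_eqF// mulr1.
  by rewrite ler_pdivrMr//; clear - L6; lra.
have I3 : (\int[supp_gaussian (1 : R) S]_x (\sum_p w3 p * F3 p x)%:E <= (4 / 100)%:E)%E.
  apply: (@le_trans _ _ (\sum_p w3 p * (if in_rect p then e + e else 0))%:E).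
    apply: integral_lincomb_le => // p; rewrite /F3.
    case: ifP => [/andP[p1 p2]|_]; last by rewrite integral0.
    apply: integralD_le => //.
      by apply: integral_coord_small => //; exact: (fintype.subsetP TS).
    by apply: integral_coord_small => //; move: p2; rewrite inE => /andP[].
  rewrite lee_fin.
  have -> : \sum_p w3 p * (if in_rect p then e + e else 0)
      = \sum_(p | in_rect p) (e + e) * (2 / Q) * gram A p.1 p.2 ^+ 2.
    rewrite [RHS]big_mkcond; apply: eq_bigr => p _; case: ifP => _; last by rewrite mulr0.
    by rewrite /w3; ring.
  rewrite -mulr_sumr -(pair_big_dep (mem T) (fun _ j => j \in S :\: T)
    (fun i j => gram A i j ^+ 2))/= -QE -!mulrA mulVf ?gt_eqF// mulr1; lra.
(* The three means add up to at most 95/100, so one point makes all three sums smaller than 1. *)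
pose psi x := \sum_gg w1 gg * F1 gg x + \sum_i w2 i * F2 i x + \sum_p w3 p * F3 p x.
have [x psi1] : exists x, psi x < 1.
  apply: (@exists_lt_integral _ _ _ (supp_gaussian (1 : R) S)) => //.
    by apply: measurable_funD; [apply: measurable_funD|]; apply: measurable_sum => k; apply: measurable_funM.
  apply: (@le_lt_trans _ _ (9 / 10 + 1 / 100 + 4 / 100)%:E); last by rewrite lte_fin; lra.
  apply: integralD_le => //; last 3 first.
  - by move=> x; rewrite addr_ge0// sumr_ge0// => k _; exact: mulr_ge0.
  - by move=> x; apply: sumr_ge0 => k _; exact: mulr_ge0.
  - apply: integralD_le => //; try by (apply: measurable_sum => k; apply: measurable_funM).
      by move=> x; apply: sumr_ge0 => k _; exact: mulr_ge0.
    by move=> x; apply: sumr_ge0 => k _; exact: mulr_ge0.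
  - by apply: measurable_funD; apply: measurable_sum => k; apply: measurable_funM.
  - by apply: measurable_sum => k; apply: measurable_funM.
have S1_ge0 : 0 <= \sum_gg w1 gg * F1 gg x by apply: sumr_ge0 => k _; exact: mulr_ge0.
have S2_ge0 : 0 <= \sum_i w2 i * F2 i x by apply: sumr_ge0 => k _; exact: mulr_ge0.
have S3_ge0 : 0 <= \sum_p w3 p * F3 p x by apply: sumr_ge0 => k _; exact: mulr_ge0.
have S1 : \sum_gg w1 gg * F1 gg x < 1 by clear - psi1 S1_ge0 S2_ge0 S3_ge0; move: psi1; rewrite /psi; lra.
have S2 : \sum_i w2 i * F2 i x < 1 by clear - psi1 S1_ge0 S2_ge0 S3_ge0; move: psi1; rewrite /psi; lra.
have S3 : \sum_p w3 p * F3 p x < 1 by clear - psi1 S1_ge0 S2_ge0 S3_ge0; move: psi1; rewrite /psi; lra.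
pose u := row_of_tuple x.
have cross : \sum_(i in T) \sum_(j in ~: T) (gram A i j * (u 0 i * u 0 j)) ^+ 2
    <= 5 * (gamma * sqnorm u) ^+ 2.
  apply: cross_gram_bound => //; set B := [set gg | _]%SET.
  have SB : \sum_gg w1 gg * F1 gg x = 20 / N * #|B|%:R.
    rewrite -mulr_sumr -sumr_mem; congr (_ * _); apply: eq_bigr => gg _.
    rewrite /F1 indicE inE; congr ((nat_of_bool _)%:R).
    by rewrite -row_of_tuple_mix; apply/idP/idP => [/set_mem|h] //; exact/mem_set.
  rewrite -/N; move: S1; rewrite SB mulrAC ltr_pdivrMr// mul1r; clear; lra.
have su : sqnorm u <= L * t.
  move: S2; rewrite -mulr_sumr mulrC ltr_pdivrMr ?(mulr_gt0 L0 t0)// mul1r => /ltW.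
  by apply: le_trans; apply: ler_sum => i _; rewrite mxE.
have su2 : 5 * (gamma * sqnorm u) ^+ 2 <= 5 * (gamma * (L * t)) ^+ 2.
  by rewrite ler_wpM2l// ler_sqr ?nnegrE ?mulr_ge0 ?sqnorm_ge0 ?(ltW L0) ?(ltW t0)// ?ler_wpM2l.
have S3Q : \sum_(p | in_rect p) gram A p.1 p.2 ^+ 2 * (sm p.1 x + sm p.2 x) <= Q / 2.
  have : \sum_p w3 p * F3 p x = 2 / Q * \sum_(p | in_rect p)
      gram A p.1 p.2 ^+ 2 * (sm p.1 x + sm p.2 x).
    rewrite mulr_sumr [RHS]big_mkcond; apply: eq_bigr => p _.
    by rewrite /w3 /F3; case: ifP => _; [field; lra|rewrite mulr0].
  by move: S3 => /[swap] ->; rewrite mulrAC ltr_pdivrMr// mul1r; clear; lra.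
have Qrect : Q = \sum_(p | in_rect p) gram A p.1 p.2 ^+ 2.
  by rewrite QE -(pair_big_dep (mem T) (fun _ j => j \in S :\: T)
      (fun i j => gram A i j ^+ 2)).
(* A pair without small coordinates contributes its squared entry times at least [e ^+ 4]; for the
   other pairs the subtracted term makes the lower bound nonpositive. *)
have low : e ^+ 4 * (Q - Q / 2) <=
    \sum_(i in T) \sum_(j in ~: T) (gram A i j * (u 0 i * u 0 j)) ^+ 2.
  apply: (@le_trans _ _ (\sum_(p | in_rect p) (gram A p.1 p.2 * (u 0 p.1 * u 0 p.2)) ^+ 2)).
    apply: (@le_trans _ _ (\sum_(p | in_rect p) e ^+ 4 * (gram A p.1 p.2 ^+ 2
        - gram A p.1 p.2 ^+ 2 * (sm p.1 x + sm p.2 x)))).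
      by rewrite -mulr_sumr sumrB ler_wpM2l ?exprn_ge0// -Qrect lerD2l lerN2.
    apply: ler_sum => p _.
    have big i : sm i x = 0 -> e ^+ 2 <= u 0 i ^+ 2.
      rewrite /sm indicE; case: (boolP (_ \in _)) => [_ /eqP|]; first by rewrite oner_eq0.
      move=> ni _; have : ~ small e (tnth x i) by move=> h; move/negP: ni; apply; exact/mem_set.
      rewrite /small/= => /negP; rewrite -leNgt mxE => h.
      by rewrite -(real_normK (num_real (tnth x i))) ler_sqr ?nnegrE.
    have sm01 i : sm i x = 0 \/ sm i x = 1.
      by rewrite /sm indicE; case: (_ \in _); [right|left].
    have g0 := sqr_ge0 (gram A p.1 p.2).
    have e4 : 0 <= e ^+ 4 by rewrite exprn_ge0.
    rewrite 2!exprMn.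
    have r0 : 0 <= gram A p.1 p.2 ^+ 2 * (u 0 p.1 ^+ 2 * u 0 p.2 ^+ 2).
      by apply: mulr_ge0 => //; apply: mulr_ge0; exact: sqr_ge0.
    have [/[dup] /big b1 ->|->] := sm01 p.1; last first.
      have h : 0 <= sm p.2 x by [].
      apply: le_trans r0; rewrite mulr_ge0_le0// mulrDr mulr1.
      by have := mulr_ge0 g0 h; lra.
    have [/[dup] /big b2 ->|->] := sm01 p.2; last first.
      by rewrite add0r mulr1 subrr mulr0.
    rewrite addr0 mulr0 subr0 mulrC ler_wpM2l// (_ : 4 = 2 + 2)%N// exprD.
    by rewrite ler_pM ?sqr_ge0.
  rewrite -(pair_big_dep (mem T) (fun _ j => j \in S :\: T)
      (fun i j => (gram A i j * (u 0 i * u 0 j)) ^+ 2))/=.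
  apply: ler_sum => i _; rewrite big_mkcond [leRHS]big_mkcond.
  apply: ler_sum => j _; rewrite !inE; case: (j \in T) => //=.
  by case: ifP => _ //; exact: sqr_ge0.
have := le_trans low (le_trans cross su2).
by rewrite (_ : Q - Q / 2 = Q / 2)//; field.
Qed.

Lemma support_cross_gram_bound (S T : {set 'I_n}) (gamma : R) :
  T \subset S -> 0 <= gamma ->
  (supp_gaussian (1 : R) S (far A gamma) <= (9 / 200)%:E)%E ->
  \sum_(i in T) \sum_(j in S :\: T) gram A i j ^+ 2
    <= 10 ^+ 15 * (gamma * #|S|%:R) ^+ 2.
Proof.
move=> TS gamma0 Pfar.
have e0 : 0 <= 1 / 100 :> R by lra.
(* With e = 1/100 and L = 600 the constant is 3.6 * 10^14, rounded up to 10^15. *)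
have := support_cross_gram_bound_aux erefl TS gamma0 e0 (lexx _) (lexx _) Pfar; rewrite /=.
set Q := \sum_(i in T) _; move: (#|S|%:R : R) => t.
have k0 : 0 < 10 ^+ 8 :> R by rewrite exprn_gt0.
have -> : (1 / 100) ^+ 4 * (Q / 2) = Q / 2 / 10 ^+ 8 by field.
have -> : 5 * (gamma * (6 * 100 * t)) ^+ 2 = 1800 * 1000 * (gamma * t) ^+ 2 by ring.
have -> : 10 ^+ 15 = 10 * 1000 * 1000 * 10 ^+ 8 :> R by ring.
have := sqr_ge0 (gamma * t).
move: (10 ^+ 8) k0 ((gamma * t) ^+ 2) => k k0 z z0.
rewrite ler_pdivrMr// => h.
by have := mulr_ge0 (ltW k0) z0; lra.
Qed.

End fixed_support_bound.

(** * Random supports as samples of coordinates *)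

Section counting_supports.
Context {R : realType}.

(** Birthday estimate: [t] uniform samples from [n] points collide with probability at most t^2 /
    (2n). *)
Lemma ffact_ge n t : (t <= n)%N ->
  n%:R ^+ t * (1 - (t%:R * t%:R) / (2 * n%:R)) <= (n ^_ t)%:R :> R.
Proof.
elim: t => [_|t IH tn]; first by rewrite expr0 ffactn0 mul1r mul0r mul0r subr0.
have n0 : 0 < n%:R :> R by rewrite ltr0n; lia.
rewrite ffactnSr natrM natrB; last exact: ltnW.
have tn' : t%:R + 1 <= n%:R :> R by rewrite natr1 ler_nat.
apply: le_trans (_ : n%:R ^+ t * (1 - t%:R * t%:R / (2 * n%:R)) * (n%:R - t%:R) <= _);
  last by rewrite ler_wpM2r ?IH//; [lra|lia].
have -> : n%:R ^+ t.+1 * (1 - t.+1%:R * t.+1%:R / (2 * n%:R)) =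
    n%:R ^+ t * (n%:R - (t%:R + 1) ^+ 2 / 2) :> R.
  by rewrite exprSr -natr1; field; rewrite gt_eqF.
rewrite -mulrA ler_wpM2l ?exprn_ge0//.
have -> : (1 - t%:R * t%:R / (2 * n%:R)) * (n%:R - t%:R) =
    n%:R - t%:R - t%:R ^+ 2 / 2 + t%:R ^+ 3 / (2 * n%:R) :> R.
  by field; rewrite gt_eqF.
have : 0 <= t%:R ^+ 3 / (2 * n%:R) :> R by rewrite divr_ge0 ?exprn_ge0// mulr_ge0// ltW.
lra.
Qed.

Context {n m : nat} (A : {linear 'rV[R]_n -> 'rV[R]_m}) (gamma : R).
Local Notation RR := (measurableTypeR R).

Definition bad_supports (c : R) t : {set {set 'I_n}} :=
  [set S : {set 'I_n} | (#|S| == t) && ~~ (supp_gaussian (1 : R) S (far A gamma) <= c%:E)%E].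

Lemma supp_gaussian_near (S : {set 'I_n}) :
  (supp_gaussian (1 : R) S [set x | near_isometric A gamma (row_of_tuple x)]
   = (1 - fine (supp_gaussian (1 : R) S (far A gamma)))%:E)%E.
Proof.
rewrite (_ : [set x | _] = ~` far A gamma); last first.
  apply/seteqP; split => x; rewrite /far/=; last by move=> /negP; rewrite negbK.
  by move=> h; apply/negP; rewrite negbK.
rewrite probability_setC; last exact: measurable_far.
by rewrite EFinB fineK// fin_num_measure//; exact: measurable_far.
Qed.

(** Markov over the random support: the failure probability has mean at most 1/100 and exceeds [c]
    on every bad support. *)
Lemma card_bad_supports c t : (t <= n)%N ->
  ((99 / 100)%:E <= Unif n t (1 : R)
     [set x | near_isometric A gamma (row_of_tuple x)])%E ->
  c * #|bad_supports c t|%:R <= 1 / 100 * 'C(n, t)%:R.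
Proof.
move=> tn; rewrite /Unif.
set C : R := 'C(n, t)%:R.
have C0 : 0 < C by rewrite ltr0n bin_gt0.
pose p (S : {set 'I_n}) := fine (supp_gaussian (1 : R) S (far A gamma)).
under eq_bigr do rewrite supp_gaussian_near -EFinM.
rewrite sumEFin lee_fin -mulr_sumr [leRHS]mulrC ler_pdivlMr// sumrB -/p.
have -> : \sum_(S : {set 'I_n} | #|S| == t) 1 = C.
  rewrite sumr_const /C; congr (_%:R).
  by rewrite -[n in RHS]card_ord -card_draws; apply: eq_card => S; rewrite inE.
move=> H.
have : \sum_(S : {set 'I_n} | #|S| == t) c * (S \in bad_supports c t)%:R
    <= \sum_(S : {set 'I_n} | #|S| == t) p S.
  apply: ler_sum => S St; rewrite inE St/=.
  have pE : supp_gaussian (1 : R) S (far A gamma) = (p S)%:E.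
    by rewrite /p fineK// fin_num_measure//; exact: measurable_far.
  rewrite pE lee_fin -ltNge; case: ltP => cS; rewrite ?mulr1 ?mulr0.
    exact: ltW.
  by rewrite /p fine_ge0.
rewrite -mulr_sumr.
have -> : \sum_(S : {set 'I_n} | #|S| == t) (S \in bad_supports c t)%:R
    = #|bad_supports c t|%:R :> R.
  rewrite -sumr_mem big_mkcond; apply: eq_bigr => S _; rewrite inE.
  by case: eqP.
lra.
Qed.

Section pairs.
Local Open Scope set_scope.
Variable h : nat.
Local Notation t := (h + h)%N.
Local Notation seqs := {ffun 'I_h -> 'I_n}.
Local Notation K := ('I_h + 'I_h)%type.

Definition join (ab : seqs * seqs) : {ffun K -> 'I_n} :=
  [ffun k => match k with inl i => ab.1 i | inr j => ab.2 j end].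

Lemma join_bij : bijective join.
Proof.
exists (fun v : {ffun K -> 'I_n} => ([ffun i => v (inl i)], [ffun j => v (inr j)])).
  by case=> a b; congr pair; apply/ffunP => i; rewrite !ffunE.
by move=> v; apply/ffunP => -[i|j]; rewrite !ffunE.
Qed.

(** Injectivity of the joined map excludes repetitions within and between the two samples, so its
    image is a support of size exactly 2h. *)
Definition good_pairs : {set seqs * seqs} :=
  [set ab | injectiveb (join ab) && (join ab @: [set: K] \notin bad_supports (9 / 200) t)].

(** At most t! injective maps have a given support of size t as image. *)
Lemma card_inj_bad :
  (#|[set v : {ffun K -> 'I_n} | injectiveb v && (v @: [set: K] \in bad_supports (9 / 200) t)]|
   <= #|bad_supports (9 / 200) t| * t`!)%N.
Proof.
rewrite -sum_nat_const.
set B := [set v | _].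
have -> : #|B| = (\sum_(S in bad_supports (9 / 200) t) #|[set v in B | v @: [set: K] == S]|)%N.
  rewrite -sum1_card (partition_big (fun v : {ffun K -> 'I_n} => v @: [set: K])
    (mem (bad_supports (9 / 200) t)))/=; last by move=> v; rewrite inE => /andP[].
  by apply: eq_bigr => S _; rewrite -sum1_card; apply: eq_bigl => v; rewrite !inE.
apply: leq_sum => S; rewrite inE => /andP[/eqP St _].
have <- : #|[set f : {ffun K -> 'I_n} in ffun_on (mem S) | injectiveb f]| = t`!.
  by rewrite card_inj_ffuns_on St card_sum !card_ord ffactnn.
apply: subset_leq_card; apply/fintype.subsetP => v; rewrite !inE.
move=> /andP[/andP[vi _] /eqP vS]; rewrite vi andbT; apply/ffun_onP => k.
by rewrite -vS imset_f.
Qed.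

(** Injective maps are at least 7/8 of all maps, as (2h)^2 / (2n) <= 1/8, and at most 2/9 of the
    injective maps have a bad image: 7/8 * 7/9 = 49/72. *)
Lemma card_good_pairs : (16 * h ^ 2 <= n)%N -> (0 < n)%N ->
  #|bad_supports (9 / 200) t|%:R <= 2 / 9 * 'C(n, t)%:R :> R ->
  49 / 72 * (n%:R ^+ h) ^+ 2 <= #|good_pairs|%:R :> R.
Proof.
move=> hn n_gt0 badR.
have tn : (t <= n)%N by nia.
set B := [set v : {ffun K -> 'I_n} | injectiveb v && (v @: [set: K] \in bad_supports (9 / 200) t)].
have cG : #|good_pairs| = #|[set v : {ffun K -> 'I_n} | injectiveb v
    && (v @: [set: K] \notin bad_supports (9 / 200) t)]|.
  rewrite -(on_card_preimset (onW_bij _ join_bij)).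
  by apply: eq_card => ab; rewrite !inE.
have : (n ^_ t <= #|good_pairs| + #|bad_supports (9 / 200) t| * t`!)%N.
  have -> : (n ^_ t = #|[set v : {ffun K -> 'I_n} | injectiveb v]|)%N.
    by rewrite card_inj_ffuns card_sum !card_ord.
  rewrite cG; apply: leq_trans (leq_add (leqnn _) card_inj_bad).
  rewrite -(cardsID [set v : {ffun K -> 'I_n} | v @: [set: K] \in bad_supports (9 / 200) t]) addnC.
  by rewrite leq_add// subset_leq_card//; apply/fintype.subsetP => v; rewrite !inE andbC.
rewrite -(ler_nat R) natrD natrM.
have : #|bad_supports (9 / 200) t|%:R * (t`!)%:R <= 2 / 9 * (n ^_ t)%:R :> R.
  by rewrite -bin_ffact natrM mulrA ler_wpM2r.
have n0 : 0 < n%:R :> R by rewrite ltr0n.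
have : n%:R ^+ t * (7 / 8) <= (n ^_ t)%:R :> R.
  apply: le_trans (ffact_ge tn); rewrite ler_wpM2l ?exprn_ge0//.
  have : (t%:R * t%:R) / (2 * n%:R) <= 1 / 8 :> R.
    rewrite ler_pdivrMr ?mulr_gt0//.
    have : (16 * h ^ 2)%:R <= n%:R :> R by rewrite ler_nat.
    by rewrite natrM natrX natrD; lra.
  lra.
rewrite exprD -expr2; lra.
Qed.

Lemma good_pairs_neq a b k l : (a, b) \in good_pairs -> a k != b l.
Proof.
rewrite inE => /andP[/injectiveP vi _]; apply/eqP => ab.
have : join (a, b) (inl k) = join (a, b) (inr l) by rewrite !ffunE.
by move/vi.
Qed.

Lemma good_pairs_cross a b : 0 <= gamma -> (a, b) \in good_pairs ->
  \sum_k \sum_l gram A (a k) (b l) ^+ 2 <= 10 ^+ 15 * (gamma * t%:R) ^+ 2.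
Proof.
move=> gamma0; rewrite inE => /andP[/injectiveP vi]; rewrite inE.
set v := join (a, b) in vi *; set S := _ @: _.
have cS : #|S| = t by rewrite card_imset// cardsT card_sum !card_ord.
rewrite cS eqxx/= negbK => Sgood.
have ai : injective a.
  move=> i j aij; have : v (inl i) = v (inl j) by rewrite !ffunE.
  by move/vi => [].
have bi : injective b.
  move=> i j bij; have : v (inr i) = v (inr j) by rewrite !ffunE.
  by move/vi => [].
pose T := a @: [set: 'I_h].
have TS : T \subset S.
  apply/fintype.subsetP => _ /imsetP[i _ ->]; apply/imsetP; exists (inl i) => //.
  by rewrite ffunE.
have ST : S :\: T = b @: [set: 'I_h].
  apply/setP => x; rewrite inE; apply/andP/imsetP => [[xT /imsetP[[i|j] _]]|[j _ ->]].
  - by rewrite ffunE => xa; move: xT; rewrite xa imset_f.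
  - by rewrite ffunE => ->; exists j.
  split; last by apply/imsetP; exists (inr j) => //; rewrite ffunE.
  apply/imsetP => -[i _ /= ba]; have : v (inr j) = v (inl i) by rewrite !ffunE.
  by move/vi.
have := support_cross_gram_bound TS gamma0 Sgood.
rewrite ST cS big_imset/=; last by move=> i j _ _; exact: ai.
apply: le_trans; rewrite le_eqVlt; apply/orP; left; apply/eqP.
apply: eq_big => [i|i _]; first by rewrite inE.
rewrite big_imset/=; last by move=> k l _ _; exact: bi.
by apply: eq_bigl => l; rewrite inE.
Qed.

End pairs.
End counting_supports.

(** * A large set of low-degree coordinates *)

Section sampled_degrees.
Context {R : realType} {V : finType}.
Variables (h : nat) (w : V -> V -> R).
Hypotheses (w0 : forall i j, 0 <= w i j) (w1 : forall i j, w i j <= 1).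
Local Notation seqs := {ffun 'I_h -> V}.
Local Notation n := (#|V|%:R : R).
Implicit Types (a b : seqs).

Definition load a j : R := \sum_k w (a k) j.

Definition load_but k a j : R := \sum_(k' | k' != k) w (a k') j.

Lemma load_ge0 a j : 0 <= load a j.
Proof. by apply: sumr_ge0. Qed.

Lemma loadE k a j : load a j = w (a k) j + load_but k a j.
Proof. by rewrite /load (bigD1 k). Qed.

Lemma load_but_le k a j : load_but k a j <= load a j.
Proof. by rewrite (loadE k) lerDr. Qed.

(** Leaving out sample [k] keeps this set unchanged when [a k] is redrawn. *)
Definition light k a : {set V} := [set j | load_but k a j <= 1 / 100].

Definition light_degree k a : R := \sum_(j in light k a) w (a k) j.

(* If load a j > 1, then at most one k has load_but k a j <= 1/100: two of them
   would force load a j <= 1/50. *)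
Lemma sum_light_degree a :
  \sum_k light_degree k a <= \sum_j Num.min (load a j) 1.
Proof.
rewrite /light_degree; under eq_bigr do rewrite big_mkcond.
rewrite exchange_big/=; apply: ler_sum => j _; rewrite le_min; apply/andP; split.
  by apply: ler_sum => k _; case: ifP.
have [l1|l1] := leP (load a j) 1.
  by apply: le_trans l1; apply: ler_sum => k _; case: ifP.
have [k kj|nk] := pickP (fun k => j \in light k a); last first.
  by rewrite big1// => k _; rewrite nk.
rewrite (bigD1 k)//= kj big1 ?addr0// => k' kk'.
case: ifP => // k'j; exfalso.
move: kj k'j; rewrite !inE => kj k'j.
have e1 := loadE k a j; have e2 := loadE k' a j.
have : w (a k') j <= load_but k a j.
  by rewrite /load_but (bigD1 k')//= lerDl sumr_ge0.
lra.
Qed.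

Definition upd k a v : seqs := [ffun k' => if k' == k then v else a k'].

(** Redrawing one entry of a uniform tuple leaves it uniform: [p] swaps the new value with the old
    one and is an involution. *)
Lemma sum_upd k (F : seqs -> R) : \sum_a \sum_v F (upd k a v) = n * \sum_a F a.
Proof.
rewrite pair_bigA/=.
pose p (x : seqs * V) := (upd k x.1 x.2, x.1 k).
have pK : involutive p.
  case=> a v; rewrite /p/=; congr pair; last by rewrite ffunE eqxx.
  by apply/ffunP => k'; rewrite !ffunE; case: eqP => // ->.
rewrite (reindex_inj (inv_inj pK))/=.
rewrite (eq_bigr (fun x : seqs * V => F x.1)); last first.
  by case=> a v _ /=; congr F; apply/ffunP => k'; rewrite !ffunE; case: eqP => // ->.
rewrite -(pair_bigA _ (fun a _ => F a))/= mulr_sumr; apply: eq_bigr => a _.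
by rewrite sumr_const mulr_natl.
Qed.

Lemma load_but_upd k a v j : load_but k (upd k a v) j = load_but k a j.
Proof. by apply: eq_bigr => k' kk'; rewrite ffunE (negbTE kk'). Qed.

Lemma light_upd k a v : light k (upd k a v) = light k a.
Proof. by apply/setP => j; rewrite !inE load_but_upd. Qed.

Lemma sum_prod_ffun (g : V -> R) : \sum_(b : seqs) \prod_k g (b k) = (\sum_v g v) ^+ h.
Proof.
rewrite -(bigA_distr_bigA (fun _ : 'I_h => g))/=.
by rewrite prodr_const card_ord.
Qed.

(** Weierstrass product inequality; the induction also carries that the product lies in [0, 1]. *)
Lemma prod_1B_ge (x : 'I_h -> R) (r : seq 'I_h) : (forall k, 0 <= x k <= 1) ->
  1 - \sum_(k <- r) x k <= \prod_(k <- r) (1 - x k).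
Proof.
move=> x01; suff : 1 - \sum_(k <- r) x k <= \prod_(k <- r) (1 - x k) /\
    0 <= \prod_(k <- r) (1 - x k) <= 1 by case.
elim: r => [|k r [IH /andP[p0 p1]]]; first by rewrite !big_nil subr0 ler01 lexx.
rewrite !big_cons; have /andP[xk0 xk1] := x01 k.
split; first by nra.
by apply/andP; split; nra.
Qed.

Lemma card_ffun_natr : #|{: seqs}|%:R = n ^+ h.
Proof. by rewrite card_ffun card_ord natrX. Qed.

Hypotheses (h8 : (8 <= h)%N) (V0 : (0 < #|V|)%N).

Let n0 : 0 < n. Proof. by rewrite ltr0n. Qed.

Variable G : {set seqs * seqs}.
Hypothesis (Gw : forall (a b : seqs) (_ : (a, b) \in G), \sum_l load a (b l) <= 1 / 100).

Definition good_rows : {set seqs} :=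
  [set a | n ^+ h <= 3 * #|[set b | (a, b) \in G]%SET|%:R].

(** Reverse Markov: a row outside [good_rows] contributes at most a third of a full row, so the
    fraction of good rows is at least (49/72 - 1/3) * 3/2 = 25/48 > 13/25. *)
Lemma card_good_rows : 49 / 72 * (n ^+ h) ^+ 2 <= #|G|%:R ->
  13 / 25 * n ^+ h <= #|good_rows|%:R.
Proof.
have N0 : 0 < n ^+ h by rewrite exprn_gt0.
have -> : #|G|%:R = \sum_a #|[set b | (a, b) \in G]%SET|%:R :> R.
  rewrite -sumr_mem (eq_bigr (fun x : seqs * seqs => ((x.1, x.2) \in G)%:R)); last by case.
  rewrite -(pair_bigA _ (fun a b => ((a, b) \in G)%:R))/=; apply: eq_bigr => a _.
  by rewrite -sumr_mem; apply: eq_bigr => b _; rewrite inE.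
have key (c N : R) : c <= N -> c <= 2 / 3 * N * (N <= 3 * c)%R%:R + N / 3.
  by move=> cN; have [c2|c2] := boolP (N <= 3 * c); [rewrite mulr1|move: c2; rewrite mulr0 -ltNge]; lra.
move=> Gge; have : \sum_a #|[set b | (a, b) \in G]%SET|%:R
    <= \sum_a (2 / 3 * n ^+ h * (a \in good_rows)%:R + n ^+ h / 3).
  apply: ler_sum => a _; rewrite inE.
  have : #|[set b | (a, b) \in G]%SET|%:R <= n ^+ h.
    by rewrite -card_ffun_natr ler_nat max_card.
  exact: key.
rewrite big_split/= -mulr_sumr sumr_mem sumr_const -[X in _ + X]mulr_natr card_ffun_natr.
move=> le2; have := le_trans Gge le2.
set N := n ^+ h in N0 *; set c : R := #|_|%:R => le3.
have : N * (49 / 72 * N) <= N * (2 / 3 * c + N / 3).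
  by apply: le_trans (le_trans _ le3) _; rewrite le_eqVlt; apply/orP; left; apply/eqP; field.
by rewrite ler_pM2l//; lra.
Qed.

(** Any [b] paired with [a] in [G] avoids the heavy set. Were that set larger, at most a fraction
    (87/100)^h < 1/3 of all [b] would do so, using h >= 8. *)
Lemma card_heavy a : a \in good_rows ->
  #|[set j | 1 / 100 < load a j]%SET|%:R <= 13 / 100 * n.
Proof.
rewrite inE => ag; set H := [set j | _]%SET; rewrite leNgt; apply/negP => Hn.
have : n ^+ h <= 3 * (\sum_v (v \notin H)%:R) ^+ h.
  apply: le_trans ag _; rewrite ler_wpM2l// -sum_prod_ffun -sumr_mem.
  apply: ler_sum => b _; rewrite inE.
  case: (boolP ((a, b) \in G)) => [/Gw ab|_]; last by apply: prodr_ge0.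
  rewrite big1// => k _; rewrite inE -leNgt.
  suff -> : load a (b k) <= 1 / 100 by [].
  apply: le_trans ab; rewrite (bigD1 k)//= lerDl.
  by apply: sumr_ge0 => l _; exact: load_ge0.
have -> : \sum_v (v \notin H)%:R = n - #|H|%:R.
  rewrite -sumr_mem -sumr_const -sumrB; apply: eq_bigr => v _.
  by case: (v \in H); rewrite ?subrr ?subr0.
apply/negP; rewrite -ltNge.
apply: (@le_lt_trans _ _ (3 * (87 / 100 * n) ^+ h)).
  have nH : 0 <= n - #|H|%:R by rewrite subr_ge0 ler_nat max_card.
  by rewrite ler_wpM2l//; apply: lerXn2r; rewrite ?nnegrE; move: nH Hn; lra.
rewrite exprMn mulrA gtr_pMl ?exprn_gt0//.
rewrite -(subnKC h8) exprD.
have : (87 / 100) ^+ 8 < 1 / 3 :> R by lra.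
have : (87 / 100) ^+ (h - 8) <= 1 :> R by apply: exprn_ile1; lra.
have : 0 <= (87 / 100) ^+ 8 :> R by apply: exprn_ge0; lra.
have : 0 <= (87 / 100) ^+ (h - 8) :> R by apply: exprn_ge0; lra.
nra.
Qed.

(* Bernoulli: if x is the mean of min(load a, 1), then (1 - x)^h >= 33/100
   and (1 - x)^h (1 + h x) <= 1. *)
Lemma sum_min_load a : a \in good_rows ->
  h%:R * \sum_j Num.min (load a j) 1 <= 41 / 20 * n.
Proof.
rewrite inE => ag; pose f j := Num.min (load a j) 1.
have f01 j : 0 <= f j <= 1 by rewrite /f le_min load_ge0 ler01 ge_min lexx orbT.
have fl j : f j <= load a j by rewrite /f ge_min lexx.
pose x := (\sum_j f j) / n.
have fx : \sum_j f j = n * x by rewrite /x mulrC divfK ?gt_eqF.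
have x0 : 0 <= x.
  apply: divr_ge0; last exact: ltW.
  by apply: sumr_ge0 => j _; case/andP: (f01 j).
have x1 : x <= 1.
  rewrite ler_pdivrMr// mul1r -sumr_const; apply: ler_sum => j _.
  by case/andP: (f01 j).
(* For [b] in the fibre of [a] the product of the [1 - f (b k)] is at least 99/100, and the fibre
   holds a third of all [b]. *)
have e1 : n ^+ h * (99 / 300) <= n ^+ h * (1 - x) ^+ h.
  rewrite -exprMn mulrBr mulr1 -fx.
  have -> : n - \sum_j f j = \sum_j (1 - f j) by rewrite sumrB sumr_const.
  rewrite -sum_prod_ffun.
  apply: (@le_trans _ _ (99 / 100 * #|[set b | (a, b) \in G]%SET|%:R)); first by lra.
  rewrite -sumr_mem mulr_sumr; apply: ler_sum => b _; rewrite inE.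
  case: (boolP ((a, b) \in G)) => [/Gw ab|_]; last first.
    by rewrite mulr0; apply: prodr_ge0 => k _; have := f01 (b k); lra.
  rewrite mulr1; apply: le_trans (prod_1B_ge _ (fun k => f01 (b k))).
  have : \sum_k f (b k) <= 1 / 100 by apply: le_trans ab; apply: ler_sum.
  by lra.
have nh0 : 0 < n ^+ h by rewrite exprn_gt0.
rewrite ler_pM2l// in e1.
have e2 : 1 + h%:R * x <= (1 + x) ^+ h.
  elim: (h) => [|k IH]; first by rewrite mul0r addr0 expr0.
  rewrite exprS -natr1; apply: le_trans (_ : (1 + x) * (1 + k%:R * x) <= _).
    have : 0 <= k%:R * x * x by apply: mulr_ge0 => //; apply: mulr_ge0.
    by lra.
  by rewrite ler_wpM2l// addr_ge0.
have e3 : (1 - x) ^+ h * (1 + x) ^+ h <= 1.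
  rewrite -exprMn; apply: exprn_ile1; nra.
have hx0 : 0 <= h%:R * x by rewrite mulr_ge0.
have : 99 / 300 * (1 + h%:R * x) <= 1.
  by apply: le_trans e3; apply: ler_pM => //; lra.
move=> e4; change (h%:R * (\sum_j f j) <= 41 / 20 * n).
by rewrite fx mulrCA mulrC ler_pM2r//; lra.
Qed.

(** Two averagings fix an index [k] and the samples other than [a k]; the set consists of the light
    values [v] for which redrawing [a k] as [v] gives a good row of small light degree. *)
Lemma exists_low_degree_set :
  (#|V| <= 20 * h ^ 2)%N -> 49 / 72 * (n ^+ h) ^+ 2 <= #|G|%:R ->
  exists U : {set V}, 24 / 100 * n <= #|U|%:R /\
    forall i, i \in U -> \sum_(j in U) w i j <= 150.
Proof.
move=> nh /card_good_rows cg.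
have h0 : 0 < h%:R :> R by rewrite ltr0n; lia.
have nh0 : 0 < n ^+ h by rewrite exprn_gt0.
have nhR : n <= 20 * h%:R ^+ 2 by rewrite -natrX -natrM ler_nat.
pose ok k a := (a \in good_rows) && (light_degree k a <= 150).
(* The light degrees sum to at most (41/20) n / h <= 41 h, so at most 41/150 of the indices exceed
   150. *)
have okk a : a \in good_rows -> 109 / 150 * h%:R <= \sum_k (ok k a)%:R :> R.
  move=> ag; have sl : \sum_k light_degree k a <= 41 * h%:R.
    have := le_trans (ler_wpM2l (ltW h0) (sum_light_degree a)) (sum_min_load ag).
    move=> le1; have : h%:R * (\sum_k light_degree k a) <= h%:R * (41 * h%:R).
      by apply: le_trans le1 _; rewrite expr2 in nhR; nra.
    by rewrite ler_pM2l.
  have : \sum_k (150 - 150 * (ok k a)%:R) <= \sum_k light_degree k a.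
    apply: ler_sum => k _; rewrite /ok ag/=.
    have : 0 <= light_degree k a by apply: sumr_ge0.
    by have [c|c] := boolP (light_degree k a <= 150); [rewrite mulr1|move: c; rewrite mulr0 -ltNge]; lra.
  by rewrite sumrB sumr_const card_ord -mulr_sumr -[X in X - _]mulr_natr; lra.
(* 13/25 * 109/150 > 37/100. *)
have [k kok] : exists k, 37 / 100 * n ^+ h <= \sum_a (ok k a)%:R.
  apply: contrapT => /forallNP nk.
  have : \sum_k \sum_a (ok k a)%:R <= \sum_(k < h) 37 / 100 * n ^+ h.
    by apply: ler_sum => k _; rewrite leNgt; apply/negP => /ltW; exact: nk.
  rewrite exchange_big/= sumr_const card_ord -[X in _ <= X -> _]mulr_natr.
  have : \sum_a 109 / 150 * h%:R * (a \in good_rows)%:R <= \sum_a \sum_k (ok k a)%:R :> R.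
    apply: ler_sum => a _; case: (boolP (a \in good_rows)) => [/okk|_].
      by rewrite mulr1.
    by rewrite mulr0; apply: sumr_ge0.
  rewrite -mulr_sumr sumr_mem; nra.
have [a aok] : exists a, 37 / 100 * n <= \sum_v (ok k (upd k a v))%:R.
  apply: contrapT => /forallNP na.
  have : \sum_a \sum_v (ok k (upd k a v))%:R < \sum_(a : seqs) 37 / 100 * n.
    apply: ltr_sum => [|a _]; last by rewrite ltNge; apply/negP; exact: na.
    by have /card_gt0P[v0 _] := V0; apply/hasP; exists [ffun=> v0].
  rewrite (sum_upd k (fun a => (ok k a)%:R)) sumr_const -[X in _ < X -> _]mulr_natr card_ffun_natr.
  by have := ler_wpM2l (ltW n0) kok; lra.
pose U0 := [set v | ok k (upd k a v)]%SET; pose J := light k a.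
have cU0 : \sum_v (ok k (upd k a v))%:R = #|U0|%:R :> R.
  by rewrite -sumr_mem; apply: eq_bigr => v _; rewrite inE.
have [v vU0] : exists v, v \in U0.
  apply/set0Pn; rewrite -card_gt0 -(ltr_nat R) -cU0.
  by apply: lt_le_trans aok; rewrite mulr_gt0.
(* Any single [v] in [U0] gives a good row, whose heavy set contains the complement of [J]. *)
have cJ : #|~: J|%:R <= 13 / 100 * n.
  have /andP[ga _] : ok k (upd k a v) by move: vU0; rewrite inE.
  apply: le_trans (card_heavy ga); rewrite ler_nat; apply: subset_leq_card.
  apply/fintype.subsetP => j; rewrite !inE -ltNge => jJ.
  by apply: lt_le_trans (load_but_le k _ _); rewrite load_but_upd.
(* 37/100 - 13/100 = 24/100. The degree of a point of [U0] into [J] is its light degree, because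
   redrawing sample [k] does not change [J]. *)
exists (U0 :&: J); split.
  have : (#|U0| <= #|U0 :&: J| + #|~: J|)%N.
    by rewrite -(cardsID J U0) leq_add2l subset_leq_card// finset.setDE finset.subsetIr.
  by rewrite -(ler_nat R) natrD -cU0; lra.
move=> i; rewrite !inE => /andP[/andP[_ +] _].
apply: le_trans; rewrite /light_degree light_upd -/J.
rewrite [leLHS]big_mkcond [leRHS]big_mkcond; apply: ler_sum => j _.
rewrite !inE ffunE eqxx; case: (ok _ _) => //=.
by case: ifP.
Qed.

End sampled_degrees.

(** * From low degrees to the rank *)

Section rank_trace.
Context {R : realType}.

Lemma sqr_sum_le m (x : 'I_m -> R) :
  (\sum_k x k) ^+ 2 <= m%:R * \sum_k x k ^+ 2.
Proof.
have -> : (\sum_k x k) ^+ 2 = \sum_k \sum_l x k * x l.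
  by rewrite expr2 big_distrlr.
have : \sum_k \sum_l 2 * (x k * x l) <= \sum_k \sum_l (x k ^+ 2 + x l ^+ 2).
  apply: ler_sum => k _; apply: ler_sum => l _.
  by have := sqr_ge0 (x k - x l); nra.
under eq_bigr do rewrite -mulr_sumr.
rewrite -mulr_sumr.
have -> : \sum_k \sum_l (x k ^+ 2 + x l ^+ 2) = 2 * (m%:R * \sum_k x k ^+ 2).
  under eq_bigr do rewrite big_split/= sumr_const card_ord -mulr_natl.
  by rewrite big_split/= -mulr_sumr sumr_const card_ord -[X in _ + X]mulr_natl; ring.
lra.
Qed.

Context {n m : nat} (A : {linear 'rV[R]_n -> 'rV[R]_m}).

(* With B the #|I| x m matrix of images of basis vectors, tr (B B^T) = tr (B^T B)
   and both have the same Frobenius norm, while B^T B has size m. *)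
Lemma sqr_trace_gram_le (I : {set 'I_n}) :
  (\sum_(i in I) gram A i i) ^+ 2
  <= m%:R * \sum_(i in I) \sum_(j in I) gram A i j ^+ 2.
Proof.
pose v i k := A (delta_mx 0 i) 0 k.
pose B k l := \sum_(i in I) v i k * v i l.
have -> : \sum_(i in I) gram A i i = \sum_k B k k by rewrite exchange_big.
have -> : \sum_(i in I) \sum_(j in I) gram A i j ^+ 2 = \sum_k \sum_l B k l ^+ 2.
  transitivity (\sum_(i in I) \sum_(j in I) \sum_k \sum_l
      (v i k * v j k) * (v i l * v j l)).
    by apply: eq_bigr => i _; apply: eq_bigr => j _; rewrite expr2 big_distrlr.
  under eq_bigr do rewrite exchange_big/=.
  rewrite exchange_big/=; apply: eq_bigr => k _.
  under eq_bigr do rewrite exchange_big/=.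
  rewrite exchange_big/=; apply: eq_bigr => l _.
  rewrite expr2 big_distrlr/=; apply: eq_bigr => i _; apply: eq_bigr => j _.
  by ring.
apply: le_trans (sqr_sum_le _) _; rewrite ler_wpM2l//; apply: ler_sum => k _.
by rewrite (bigD1 k)//= lerDl; apply: sumr_ge0 => l _; exact: sqr_ge0.
Qed.

End rank_trace.

(** * Colourings with little weight inside the classes *)

Section partition.
Context {R : realType} {V : finType}.

(* A colouring minimising the total weight inside the colour classes. *)
Lemma exists_balanced_coloring p (f : V -> V -> R) (U : {set V}) :
  (forall i j, f i j = f j i) ->
  exists c : V -> 'I_p.+1, forall i, i \in U ->
    p.+1%:R * \sum_(j in U | (j != i) && (c j == c i)) f i j
    <= \sum_(j in U | j != i) f i j.
Proof.
move=> fC.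
pose g (c : {ffun V -> 'I_p.+1}) x y := if (y != x) && (c y == c x) then f x y else 0.
have gC c x y : g c x y = g c y x by rewrite /g eq_sym (eq_sym (c x)) fC.
pose E c := \sum_(x in U) \sum_(y in U) g c x y.
have [c _ cmin] := @arg_minP _ R {ffun V -> 'I_p.+1} [ffun=> ord0] predT E isT.
exists c => i iU.
have Esplit (c' : {ffun V -> 'I_p.+1}) : E c' = 2 * (\sum_(y in U | y != i) g c' i y)
    + \sum_(x in U | x != i) \sum_(y in U | y != i) g c' x y.
  rewrite /E (bigD1 i iU)/= [X in X + _](bigD1 i iU)/= {1}/g eqxx add0r.
  have -> : \sum_(x in U | x != i) \sum_(y in U) g c' x y
      = \sum_(x in U | x != i) (g c' i x + \sum_(y in U | y != i) g c' x y).
    by apply: eq_bigr => x _; rewrite (bigD1 i iU)/= gC.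
  by rewrite big_split/= mulr_natl mulr2n addrA.
have gE (c' : {ffun V -> 'I_p.+1}) q : c' i = q ->
    \sum_(y in U | y != i) g c' i y = \sum_(j in U | (j != i) && (c' j == q)) f i j.
  move=> c'i; rewrite [LHS]big_mkcondr [RHS]big_mkcondr; apply: eq_bigr => y _.
  by rewrite /g c'i; case: (y != i).
(* Recolouring [i] alone changes only the first term of [Esplit], so minimality compares its weight
   in its own class with that in class [q]. *)
have mono q : \sum_(j in U | (j != i) && (c j == c i)) f i j
    <= \sum_(j in U | (j != i) && (c j == q)) f i j.
  pose c' : {ffun V -> 'I_p.+1} := [ffun x => if x == i then q else c x].
  have c'N x : x != i -> c' x = c x by move=> xi; rewrite ffunE (negbTE xi).
  have := cmin c' isT; rewrite !Esplit (gE c _ erefl) (gE c' q); last by rewrite ffunE eqxx.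
  have -> : \sum_(x in U | x != i) \sum_(y in U | y != i) g c' x y
      = \sum_(x in U | x != i) \sum_(y in U | y != i) g c x y.
    apply: eq_bigr => x /andP[_ xi]; apply: eq_bigr => y /andP[_ yi].
    by rewrite /g !c'N.
  have -> : \sum_(j in U | (j != i) && (c' j == q)) f i j
      = \sum_(j in U | (j != i) && (c j == q)) f i j.
    by apply: eq_bigl => j; case: (boolP (j != i)) => // ji; rewrite c'N.
  lra.
rewrite mulr_natl -[X in _ *+ X](card_ord p.+1) -sumr_const.
have -> : \sum_(j in U | j != i) f i j
    = \sum_q \sum_(j in U | (j != i) && (c j == q)) f i j.
  rewrite (partition_big c predT)//=; apply: eq_bigr => q _.
  by apply: eq_bigl => j; rewrite andbA.
by apply: ler_sum => q _.
Qed.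

End partition.

(** * Diagonal entries of the Gram matrix *)

Section diagonal.
Context {R : realType} {n m : nat} (A : {linear 'rV[R]_n -> 'rV[R]_m}).
Local Notation RR := (measurableTypeR R).

(** Near isometry is homogeneous, so a single nonzero multiple of the [i]-th basis vector satisfying
    it is enough. *)
Lemma gram_diag i gamma :
  (supp_gaussian (1 : R) [set i]%SET (far A gamma) <= (1 / 2)%:E)%E ->
  `|gram A i i - 1| <= gamma.
Proof.
move=> Pfar; set S := [set i]%SET in Pfar.
(* [B j] are events to avoid. Coordinate [i] is small with probability at most 1/4, the others
   vanish almost surely, and 1/2 + 1/4 < 1. *)
pose B j : set RR := if j == i then small (1 / 4) else ~` [set 0].
have mB j : measurable (B j).
  by rewrite /B; case: eqP => _; [exact: measurable_small|apply: measurableC; exact: measurable_set1].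
pose F (j : 'I_n) (x : n.-tuple RR) : R := \1_(B j) (tnth x j).
have mF j : measurable_fun setT (F j).
  apply: (@measurableT_comp _ _ _ _ _ _ (\1_(B j) : RR -> R)).
    exact: measurable_indic.
  exact: measurable_tnth.
have mf : measurable_fun setT (\1_(far A gamma) : n.-tuple RR -> R).
  by apply: measurable_indic; exact: measurable_far.
have q0 : 0 <= 1 / 4 :> R by lra.
have F0 j x : 0 <= F j x by [].
have IF : (\int[supp_gaussian (1 : R) S]_x (\sum_j 1 * F j x)%:E
    <= (\sum_j 1 * (if j == i then 1 / 4 else 0))%:E)%E.
  apply: integral_lincomb_le => // j; rewrite integral_coord_indic// /B.
  case: eqP => [->|/eqP ji]; first by apply: coord_law_small => //; rewrite inE.
  rewrite /coord_law inE (negbTE ji) /= /dirac indicE.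
  by case: (boolP (_ \in _)) => // /set_mem/= [].
have [x x1] : exists x, \1_(far A gamma) x + \sum_j 1 * F j x < (1 : R).
  apply: (@exists_lt_integral _ _ _ (supp_gaussian (1 : R) S)) => //.
    by apply: measurable_funD => //; apply: measurable_sum => j; apply: measurable_funM.
  apply: (@le_lt_trans _ _ (1 / 2 + 1 / 4)%:E); last by rewrite lte_fin; lra.
  apply: integralD_le => //.
  - by apply: measurable_sum => j; apply: measurable_funM.
  - by move=> y; apply: sumr_ge0 => j _; rewrite mul1r.
  - by rewrite integral_indic ?setIT//; exact: measurable_far.
  - apply: le_trans IF _; rewrite lee_fin (bigD1 i)//= eqxx big1 ?addr0 ?mul1r//.
    by move=> j /negbTE ->; rewrite mulr0.
have xfar : near_isometric A gamma (row_of_tuple x).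
  apply: contraT => xf; move: x1; rewrite indicE mem_set//.
  have : 0 <= \sum_j 1 * F j x by apply: sumr_ge0 => j _; rewrite mul1r.
  by rewrite mulr1n; lra.
have xB j : ~ B j (tnth x j).
  move=> xb; move: x1; rewrite (bigD1 j)//= mul1r.
  have -> : F j x = 1 by rewrite /F indicE mem_set.
  have : 0 <= \sum_(k | k != j) 1 * F k x by apply: sumr_ge0 => k _; rewrite mul1r.
  have : 0 <= \1_(far A gamma) x :> R by [].
  by lra.
have xj j : j != i -> tnth x j = 0.
  move=> ji; have := xB j; rewrite /B (negbTE ji) => h.
  by apply: contrapT => h'; exact: h.
have xi : 1 / 4 <= `|tnth x i|.
  by have := xB i; rewrite /B eqxx /small/= => /negP; rewrite -leNgt.
have ux : row_of_tuple x = tnth x i *: delta_mx 0 i.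
  apply/rowP => j; rewrite !mxE eqxx/=; case: eqP => [->|/eqP /xj ->].
    by rewrite mulr1.
  by rewrite mulr0.
have sZ k (c : R) (v : 'rV[R]_k) : sqnorm (c *: v) = c ^+ 2 * sqnorm v.
  by rewrite /sqnorm mulr_sumr; apply: eq_bigr => j _; rewrite mxE exprMn.
have sd : sqnorm (delta_mx 0 i : 'rV[R]_n) = 1.
  rewrite /sqnorm (bigD1 i)//= mxE !eqxx expr1n big1 ?addr0// => j /negbTE ji.
  by rewrite mxE ji andbF expr0n.
move: xfar; rewrite /near_isometric ux linearZ !sZ sd mulr1 (sqnormE (A _)) -/(gram A i i).
have x2 : 0 < tnth x i ^+ 2.
  by rewrite exprn_even_gt0//= -normr_gt0; lra.
rewrite -{2}(mulr1 (tnth x i ^+ 2)) -mulrBr normrM (gtr0_norm x2) [leRHS]mulrC.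
by rewrite ler_pM2l.
Qed.

End diagonal.

(** * The dimension bound from low degrees *)

Section low_rank.
Context {R : realType} {n m : nat} (A : {linear 'rV[R]_n -> 'rV[R]_m}).

Definition coherence (i j : 'I_n) : R :=
  if i == j then 1 else Num.min (100 * gram A i j ^+ 2) 1.

Lemma coherence_ge0 i j : 0 <= coherence i j.
Proof.
by rewrite /coherence; case: eqP => // _; rewrite le_min ler01 andbT mulr_ge0 ?sqr_ge0.
Qed.

Lemma coherence_le1 i j : coherence i j <= 1.
Proof. by rewrite /coherence; case: eqP => // _; rewrite ge_min lexx orbT. Qed.

Lemma coherenceC i j : coherence i j = coherence j i.
Proof. by rewrite /coherence eq_sym gramC. Qed.

Lemma low_degree_rank_bound (gamma : R) (U : {set 'I_n}) :
  0 <= gamma <= 1 / 1000 ->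
  (forall i, i \in U -> `|gram A i i - 1| <= gamma) ->
  (forall i, i \in U -> \sum_(j in U) coherence i j <= 150) ->
  #|U|%:R <= 160 * m%:R :> R.
Proof.
move=> /andP[g0 g1] Udiag Udeg.
have [c cU] := exists_balanced_coloring 150 U coherenceC.
pose I q := [set i in U | c i == q]%SET.
have [q Iq] : exists q, #|U|%:R <= 151 * #|I q|%:R :> R.
  apply: contrapT => /forallNP nq.
  have : \sum_(q < 151) (151 * #|I q|%:R) < \sum_(q < 151) #|U|%:R :> R.
    apply: ltr_sum => [|q _]; last by rewrite ltNge; apply/negP; exact: nq.
    by apply/hasP; exists ord0.
  rewrite sumr_const card_ord -mulr_sumr -natr_sum.
  have -> : (\sum_(q < 151) #|I q| = #|U|)%N.
    rewrite -sum1_card (partition_big c predT)//=; apply: eq_bigr => q _.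
    by rewrite -sum1_card; apply: eq_bigl => i; rewrite inE.
  by rewrite mulr_natl ltxx.
have IU i : i \in I q -> i \in U by rewrite inE => /andP[].
have off i : i \in I q -> \sum_(j in I q | j != i) gram A i j ^+ 2 <= 1 / 100.
  move=> iI; have iU := IU _ iI.
  (* The diagonal takes 1 out of the degree 150, and the remaining 149 is divided by 151 colours. *)
  have cl : \sum_(j in I q | j != i) coherence i j < 1.
    have := cU i iU; have := Udeg i iU; rewrite (bigD1 i iU)/= {1}/coherence eqxx.
    have -> : \sum_(j in U | (j != i) && (c j == c i)) coherence i j
      = \sum_(j in I q | j != i) coherence i j.
      apply: eq_bigl => j; move: iI; rewrite !inE => /andP[_ /eqP ->].
      by rewrite andbAC andbA.
    lra.
  (* A sum below 1 forces each term below 1, so the truncation in [coherence] is inactive inside the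
     class. *)
  have wj j : j \in I q -> j != i -> coherence i j = 100 * gram A i j ^+ 2.
    move=> jI ji; have : coherence i j < 1.
      apply: le_lt_trans cl; rewrite (bigD1 j) ?jI//= lerDl.
      by apply: sumr_ge0 => k _; exact: coherence_ge0.
    rewrite /coherence eq_sym (negbTE ji).
    by have [_|_] := leP (100 * gram A i j ^+ 2) 1; rewrite ?ltxx.
  have : \sum_(j in I q | j != i) 100 * gram A i j ^+ 2 <= 1.
    apply: le_trans (ltW cl); rewrite le_eqVlt; apply/orP; left; apply/eqP.
    by apply: eq_bigr => j /andP[jI ji]; rewrite wj.
  by rewrite -mulr_sumr; lra.
have diag i : i \in I q -> 999 / 1000 <= gram A i i <= 1001 / 1000.
  by move=> /IU /Udiag; rewrite ler_norml => /andP[? ?]; apply/andP; split; lra.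
have := sqr_trace_gram_le A (I q); set N : R := #|I q|%:R in Iq *.
have N0 : 0 <= N by [].
have tr : 999 / 1000 * N <= \sum_(i in I q) gram A i i.
  rewrite /N -sumr_const mulr_sumr; apply: ler_sum => i iI.
  by rewrite mulr1; case/andP: (diag i iI).
have fr : \sum_(i in I q) \sum_(j in I q) gram A i j ^+ 2 <= 102 / 100 * N.
  rewrite /N -sumr_const mulr_sumr; apply: ler_sum => i iI.
  rewrite (bigD1 i iI)/= mulr1; have := off i iI; have := diag i iI => /andP[d1 d2].
  by nra.
move=> tf; have m0 : 0 <= m%:R :> R by [].
(* Dividing by N gives N <= 1.03 m, and 151 * 1.03 < 160. *)
have : (999 / 1000 * N) ^+ 2 <= m%:R * (102 / 100 * N).
  apply: le_trans (le_trans tf _); last by rewrite ler_wpM2l.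
  have tN : 0 <= 999 / 1000 * N by move: N0; lra.
  have tr0 := le_trans tN tr.
  by move: tN tr tr0; move: (999 / 1000 * N) (\sum_(i in I q) _) => a b a0 ab b0; rewrite ler_sqr.
have [N0'|N1] := eqVneq N 0; first by rewrite N0' in Iq *; lra.
have Np : 0 < N by rewrite lt_def N1.
rewrite (_ : (_ * N) ^+ 2 = N * ((999 / 1000) ^+ 2 * N)); last by ring.
rewrite (_ : m%:R * _ = N * (102 / 100 * m%:R)); last by ring.
by rewrite ler_pM2l//; lra.
Qed.

End low_rank.

(** * The lower bound *)

(** By [gram_diag], each such coordinate is a bad support of size 1 at threshold 1/2. *)
Lemma card_off_diagonal (R : realType) n m (A : {linear 'rV[R]_n -> 'rV[R]_m}) gamma :
  (0 < n)%N ->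
  ((99 / 100)%:E <= Unif n 1 (1 : R)
     [set x | near_isometric A gamma (row_of_tuple x)])%E ->
  #|[set i | gamma < `|gram A i i - 1|]%SET|%:R <= n%:R / 50 :> R.
Proof.
move=> n0 H; set D := [set i | _]%SET.
have := card_bad_supports (1 / 2) n0 H; rewrite bin1.
have : (#|D| <= #|bad_supports A gamma (1 / 2) 1|)%N.
  rewrite -(card_imset D (@set1_inj _)); apply: subset_leq_card.
  apply/fintype.subsetP => _ /imsetP[i iD ->]; rewrite inE cards1 eqxx /=.
  by apply/negP => /gram_diag; move: iD; rewrite inE ltNge => /negP.
by rewrite -(ler_nat R); lra.
Qed.

Lemma rank_bound_large (R : realType) (s m : nat) gamma
    (A : {linear 'rV[R]_(s ^ 2) -> 'rV[R]_m}) :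
  (32 <= s)%N -> 0 <= gamma -> gamma * s%:R <= (10 ^+ 10)^-1 -> gamma <= 1 / 1000 ->
  (forall t, (1 <= t <= s)%N -> ((99 / 100)%:E <= Unif (s ^ 2) t (1 : R)
     [set x | near_isometric A gamma (row_of_tuple x)])%E) ->
  (s ^ 2)%:R / 1000 <= m%:R :> R.
Proof.
move=> s32 g0 gs g1 H; pose h := (s %/ 4)%N.
have h8 : (8 <= h)%N by rewrite /h; lia.
have sh : (4 * h <= s <= 4 * h + 3)%N by rewrite /h; lia.
have [sh1 sh2] := andP sh.
have hn : (16 * h ^ 2 <= s ^ 2)%N by nia.
(* (4h + 3)^2 <= 20 h^2 holds because h >= 8. *)
have nh : (s ^ 2 <= 20 * h ^ 2)%N by nia.
have n0 : (0 < s ^ 2)%N by nia.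
have tn : (h + h <= s ^ 2)%N by nia.
(* 2/9 is (1/100) / (9/200). *)
have badR : #|bad_supports A gamma (9 / 200) (h + h)|%:R <= 2 / 9 * 'C(s ^ 2, h + h)%:R :> R.
  have := card_bad_supports (9 / 200) tn (H (h + h)%N ltac:(lia)).
  by lra.
have cG := card_good_pairs hn n0 badR.
have Gw : forall (a b : {ffun 'I_h -> 'I_(s ^ 2)}), (a, b) \in good_pairs A gamma h ->
    \sum_l load (coherence A) a (b l) <= 1 / 100.
  (* The size of C enters here: 100 * 10^15 * (10^-10)^2 = 10^-3 <= 1/100. *)
  move=> a b ab; apply: (@le_trans _ _ (100 * \sum_k \sum_l gram A (a k) (b l) ^+ 2)).
    rewrite exchange_big/= mulr_sumr; apply: ler_sum => l _.
    rewrite mulr_sumr; apply: ler_sum => k _.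
    by rewrite /coherence (negbTE (good_pairs_neq l k ab)) ge_min lexx.
  have := good_pairs_cross g0 ab.
  have gt : gamma * (h + h)%:R <= (10 ^+ 10)^-1.
    by apply: le_trans gs; rewrite ler_wpM2l// ler_nat; lia.
  have gt0 : 0 <= gamma * (h + h)%:R by rewrite mulr_ge0.
  have : (gamma * (h + h)%:R) ^+ 2 <= ((10 ^+ 10)^-1) ^+ 2.
    by rewrite ler_sqr// nnegrE; exact: le_trans gt.
  have k0 : 0 < 10 ^+ 15 :> R by rewrite exprn_gt0.
  have -> : ((10 ^+ 10)^-1) ^+ 2 = (10 ^+ 15)^-1 / (10 * 10 * 10 * 10 * 10) :> R by field.
  move: (_ ^+ 2) => z; move: (10 ^+ 15) k0 => k k0 z1 z2.
  have : k * z <= k * (k^-1 / (10 * 10 * 10 * 10 * 10)) by rewrite ler_pM2l.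
  rewrite mulrA divff ?gt_eqF//; lra.
have h0 : (0 < #|'I_(s ^ 2)|)%N by rewrite card_ord.
have [||U [cU dU]] := exists_low_degree_set (coherence_ge0 A) (coherence_le1 A) h8 h0 Gw.
- by rewrite card_ord.
- by rewrite card_ord.
have cD := card_off_diagonal n0 (H 1%N ltac:(lia)).
set D := [set i | _]%SET in cD.
have : #|U :\: D|%:R <= 160 * m%:R :> R.
  apply: (@low_degree_rank_bound _ _ _ A gamma).
  - by rewrite g0.
  - by move=> i; rewrite !inE -leNgt => /andP[].
  - move=> i iU; apply: le_trans (dU i _); last by move: iU; rewrite inE => /andP[].
    rewrite [leLHS]big_mkcond [leRHS]big_mkcond; apply: ler_sum => j _.
    by rewrite inE; case: (j \in D); case: (j \in U) => //=; exact: coherence_ge0.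
have : (#|U| <= #|U :\: D| + #|D|)%N.
  by rewrite -(cardsID D U) addnC leq_add2l subset_leq_card// finset.subsetIr.
rewrite -(ler_nat R) natrD => le1 le2; rewrite card_ord in cU.
(* 24/100 - 1/50 = 22/100, and 22/100 divided by 160 exceeds 1/1000. *)
have lin (n u d ud mm : R) : d <= n / 50 -> 24 / 100 * n <= u -> u <= ud + d ->
  ud <= 160 * mm -> 0 <= mm -> n / 1000 <= mm by lra.
exact: lin cD cU le1 le2 (ler0n _ _).
Qed.

Theorem mainTheorem2 (R : realType) :
  exists C : R, 0 < C /\
    forall (s : nat) (gamma : R) (m : nat)
           (A : {linear 'rV[R]_(s ^ 2) -> 'rV[R]_m}),
      (1 <= s)%N ->
      0 <= gamma <= C / s%:R ->
      (forall t : nat, (1 <= t <= s)%N ->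
         ((99 / 100)%:E <=
          Unif (s ^ 2) t (1 : R)
            [set x | let u := row_of_tuple x in
               (`|sqnorm (A u) - sqnorm u| <= gamma * sqnorm u)%R])%E) ->
      (s ^ 2)%:R / 1000 <= m%:R :> R.
Proof.
exists (10 ^+ 10)^-1; split; first by rewrite invr_gt0 exprn_gt0.
move=> s gamma m A s1 /andP[g0 gC] H.
have s0 : 0 < s%:R :> R by rewrite ltr0n.
have gs : gamma * s%:R <= (10 ^+ 10)^-1 by rewrite -ler_pdivlMr.
have g1 : gamma <= 1 / 1000.
  apply: (@le_trans _ _ (gamma * s%:R)); first by rewrite ler_peMr// ler1n.
  apply: le_trans gs _.
  have -> : 1 / 1000 = (10 ^+ 3)^-1 :> R by field.
  by rewrite lef_pV2 ?posrE ?exprn_gt0// ler_eXn2l ?ltr1n.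
(* For s < 32 one has s^2 < 1000, so only m = 0 remains to be excluded. *)
have [s32|s32] := leqP 32 s; first exact: (rank_bound_large s32 g0 gs g1 H).
have n0 : (0 < s ^ 2)%N by nia.
have := card_off_diagonal n0 (H 1%N ltac:(lia)).
set D := [set i | _]%SET => cD.
case: m => [|m] in A H D cD *; last first.
  have : (s ^ 2)%:R <= (1000)%:R :> R by rewrite ler_nat; nia.
  have : 1 <= m.+1%:R :> R by rewrite ler1n.
  lra.
have [i iD] : exists i, i \notin D.
  apply: contrapT => /forallNP nD.
  have : (s ^ 2 <= #|D|)%N.
    rewrite -[leqLHS]card_ord; apply: subset_leq_card; apply/fintype.subsetP => i _.
    by apply: contraT => iD; case: (nD i).
  rewrite -(ler_nat R) => le1; have : 0 < (s ^ 2)%:R :> R by rewrite ltr0n.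
  lra.
(* For m = 0 the Gram entry is an empty sum, so its distance to 1 is 1, above [gamma]. *)
move: iD; rewrite inE -leNgt /gram /dotp big_ord0 sub0r normrN normr1; lra.
Qed.
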